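(* Let $\mathbb K\in\{\mathbb R,\mathbb C\}$, and let $X\subseteq\mathbb K^n$ be an analytic hypersurface with $0\in X$, defined near $0$ by $$X=\{x\in\mathbb K^n:\ f(x)=0\},$$ where $f=f_m+f_{m+1}+f_{m+2}+\cdots$ is the expansion of the analytic function $f$ at $0$ into homogeneous components and $f_m=f^{[*]}$ is the initial homogeneous part. Let $u\in T_0X\setminus\{0\}$. If $$\nabla f_m(u)\neq0,$$ then $X$ is second-order realizable along $u$. Consequently, $T^2_{0,u}X=T^{2,a}_{0,u}X$.
   Context: An analytic function is one that is locally given by convergent power series (real-analytic for $\mathbb K=\mathbb R$, holomorphic for $\mathbb K=\mathbb C$). $\mathcal I(X,0)$ is the ideal of germs at $0$ of analytic functions on $\mathbb K^n$ that vanish on $X\cap V$ for some neighborhood $V$ of $0$. Geometric tangent cone: $T_0X$ is the set of $v\in\mathbb K^n$ for which there are $x_k\in X\setminus\{0\}$ and real $t_k>0$ with $x_k\to0$ and $t_kx_k\to v$. For a nonzero germ $g=g_m+g_{m+1}+\cdots$ (power series expansion at $0$ into homogeneous polynomials $g_j$ of degree $j$, with $g_m\not\equiv0$), $g^{[*]}:=g_m$ is the initial form and $g^{[*]+1}:=g_{m+1}$ (possibly zero). $T^2_{0,u}X$ is the set of all $w\in\mathbb K^n$ for which there are positive real numbers $t_k\downarrow0$ and $w_k\in\mathbb K^n$ with $w_k\to w$ such that $t_ku+\frac12t_k^2w_k\in X$ for every $k$. $T^{2,a}_{0,u}X:=\{w\in\mathbb K^n:\ \tfrac12\langle\nabla g^{[*]}(u),w\rangle+g^{[*]+1}(u)=0\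 \text{ for all nonzero } g\in\mathcal I(X,0)\}$, where $\nabla$ is the vector of partial derivatives over $\mathbb K$ and $\langle a,b\rangle=\sum_i a_ib_i$ (bilinear). $X$ is second-order realizable along $u$ if for every $w\in T^{2,a}_{0,u}X$ there exist $\varepsilon>0$ and an analytic curve $\gamma:(0,\varepsilon)\to X$ such that $\gamma(t)=tu+\frac12t^2w+o(t^2)$ as $t\to0^+$. A curve on the real interval $(0,\varepsilon)$ is analytic if near each point its components are given by convergent power series in $t$ with coefficients in $\mathbb K$. *)

(* Defs.v *)
From HB Require Import structures.
From mathcomp Require Import all_boot all_order all_algebra.
From mathcomp Require Import complex.
From mathcomp Require Import all_classical all_reals all_analysis.
(* The notations of mpoly clash with those of MathComp-Analysis. *)
From mathcomp Require Import -(notations) mpoly.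

Set Implicit Arguments.
Unset Strict Implicit.
Unset Printing Implicit Defensive.

Import Order.TTheory GRing.Theory Num.Theory.
Import numFieldNormedType.Exports.

Local Open Scope classical_set_scope.
Local Open Scope ring_scope.

(* The base field is R or R[i], both handled as a [numFieldType] K. The order
   of R[i] is the partial one for which [0 < z] says that z is a positive real
   number and [z \is Num.real] that z is a real number; real parameters are
   therefore elements of K subject to one of these conditions. *)
Variant real_or_complex (R : realType) : numFieldType -> Prop :=
  | IsReal : real_or_complex R R
  | IsComplex : real_or_complex R R[i].

Section SecondOrder.
Variables (K : numFieldType) (n : nat).
Implicit Types (X : set 'rV[K]_n) (f g : 'rV[K]_n -> K) (u w a : 'rV[K]_n).
Implicit Types (c : multinom n -> K).

Definition monomial (x : 'rV[K]_n) (m : multinom n) : K :=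
  \prod_(i < n) x 0 i ^+ m i.

(* Near a, g is the sum of the absolutely convergent power series centred at a
   with coefficients c; the N-th partial sum is over the multi-indices of total
   degree less than N. *)
Definition has_power_series g a c : Prop :=
  \forall x \near (0 : 'rV[K]_n),
    cvgn ((fun N => \sum_(m : bmultinom n N) `|c m * monomial x m|) : K^nat) /\
    ((fun N => \sum_(m : bmultinom n N) c m * monomial x m) : K^nat) @ \oo
      --> g (a + x).

Definition analytic_at g a : Prop := exists c, has_power_series g a c.

Definition analytic_germ g : Prop :=
  \forall a \near (0 : 'rV[K]_n), analytic_at g a.

Definition homog_part c (j : nat) : mpoly n K :=
  \sum_(m : bmultinom n j.+1 | mdeg m == j) c m *: mpolyX K m.

(* Such a degree exists exactly when c <> 0, i.e. when the germ is nonzero. *)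
Definition initial_degree c (d : nat) : Prop :=
  (forall j, (j < d)%N -> homog_part c j = 0) /\ homog_part c d <> 0.

Definition eval (p : mpoly n K) (x : 'rV[K]_n) : K :=
  meval (x 0) p.

Definition grad (p : mpoly n K) (x : 'rV[K]_n) : 'rV[K]_n :=
  \row_(i < n) eval (mderiv i p) x.

Definition pairing (a b : 'rV[K]_n) : K := \sum_(i < n) a 0 i * b 0 i.

Definition vanishing_ideal X : set ('rV[K]_n -> K) :=
  [set g | analytic_germ g /\
           \forall x \near (0 : 'rV[K]_n), X x -> g x = 0].

Definition tangent_cone X : set 'rV[K]_n :=
  [set v | exists (x : nat -> 'rV[K]_n) (t : nat -> K),
    [/\ forall k, X (x k) /\ x k != 0,
        forall k, 0 < t k,
        x @ \oo --> (0 : 'rV[K]_n) &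
        (fun k => t k *: x k) @ \oo --> v]].

Definition second_tangent_set X u : set 'rV[K]_n :=
  [set w | exists (t : nat -> K) (w_ : nat -> 'rV[K]_n),
    [/\ forall k, 0 < t k,
        nonincreasing_seq t /\ t @ \oo --> (0 : K),
        w_ @ \oo --> w &
        forall k, X (t k *: u + (2^-1 * t k ^+ 2) *: w_ k)]].

Definition algebraic_second_tangent_set X u : set 'rV[K]_n :=
  [set w | forall g c d, vanishing_ideal X g -> has_power_series g 0 c ->
    initial_degree c d ->
    2^-1 * pairing (grad (homog_part c d) u) w
      + eval (homog_part c d.+1) u = 0].

(* Only the values of gamma at the real numbers of (0, e) matter. *)
Definition analytic_curve (e : K) (gamma : K -> 'rV[K]_n) : Prop :=
  forall t0 : K, 0 < t0 < e -> forall i : 'I_n, exists a : nat -> K,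
    \forall t \near within [set t | t \is Num.real] (nbhs t0),
      series (fun k => a k * (t - t0) ^+ k) @ \oo --> gamma t 0 i.

Definition second_order_realizable X u : Prop :=
  forall w, algebraic_second_tangent_set X u w ->
  exists (e : K) (gamma : K -> 'rV[K]_n),
    [/\ 0 < e,
        forall t, 0 < t < e -> X (gamma t),
        analytic_curve e gamma &
        gamma = (fun t => t *: u + (2^-1 * t ^+ 2) *: w)
          +o_ (0^'+) (fun t => t ^+ 2 : K^o)].

End SecondOrder.

(* Main.v *)
(* Put x(t) = t u + t^2 w / 2 + t^2 s e_l, where l is a coordinate with
   a = d_l f_m (u) <> 0. Since f_m(u) = 0 and w satisfies the second-order
   equation, f(x(t)) = a t^(m+1) (s - t H(t, s)) with H analytic, so s(t) is a
   fixed point of s |-> t H(t, s). Its iterates are polynomials in t that stay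
   in the unit ball of a weighted l^1 norm on coefficients and stabilize modulo
   growing powers of t, hence converge in that norm at half the radius; recentring
   them at t0 preserves this, which gives the power series of the curve at t0.
   The norm is submultiplicative, so only finite sums are ever rearranged, and the
   argument is the same over R and over C.
   The inclusion of T^2 in T^{2,a} is the expansion of g(t u + t^2 w_k / 2) to
   order d + 1, d being the degree of the initial form of g. *)

Require Import Defs.
From HB Require Import structures.
From mathcomp Require Import all_boot all_order all_algebra.
From mathcomp Require Import complex.
From mathcomp Require Import all_classical all_reals all_analysis.
From mathcomp Require Import -(notations) mpoly.
From mathcomp Require Import ring.

Set Implicit Arguments.
Unset Strict Implicit.
Unset Printing Implicit Defensive.

Import Order.TTheory GRing.Theory Num.Theory.
Import numFieldNormedType.Exports.

Local Open Scope classical_set_scope.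
Local Open Scope ring_scope.

(* MathComp-Analysis also defines an [eval]. *)
Local Notation eval := Defs.eval.

(** * Completeness of the base field along geometric sequences *)

Lemma geometric_eps (K : numFieldType) : ((fun k => 2^-1 ^+ k) : K^nat) @ \oo --> (0 : K) ->
  forall C e : K, 0 <= C -> 0 < e -> \forall k \near \oo, C / 2 ^+ k <= e.
Proof.
move=> h C e C0 e0.
(* [C] may vanish, hence the denominator [C + 1]. *)
have e1 : 0 < e / (C + 1) by rewrite divr_gt0 // ltr_wpDl.
move/cvgrPdist_le: h => /(_ _ e1); apply: filterS => k.
rewrite sub0r normrN ger0_norm ?exprn_ge0 ?invr_ge0 ?ler0n // exprVn => hk.
have -> : e = (C + 1) * (e / (C + 1)).
  by rewrite mulrCA divff ?mulr1 // gt_eqF // ltr_wpDl.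
by apply: ler_pM => //; rewrite ?invr_ge0 ?exprn_ge0 // lerDl.
Qed.

(* All that is used of the field; the library has no completeType instance on
   R[i]. *)
Definition geometrically_complete (K : numFieldType) : Prop :=
  ((fun k => 2^-1 ^+ k) : K^nat) @ \oo --> (0 : K) /\
  forall (p : K^nat) (C : K),
    (forall m n, (m <= n)%N -> `|p n - p m| <= C / 2 ^+ m) ->
    exists l : K, p @ \oo --> l.

Lemma real_geometrically_complete (R : realType) : geometrically_complete R.
Proof.
have h0 : ((fun k => 2^-1 ^+ k) : R^nat) @ \oo --> (0 : R).
  have hh : `|2^-1 : R| < 1 by rewrite ger0_norm ?invr_ge0 // invf_lt1 // ltr1n.
  by have := cvg_expr hh.
split=> // p C hp.
have C0 : 0 <= C by have := hp 0 0 (leqnn _); rewrite subrr normr0 expr0 divr1.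
suff : cvgn p by move=> /cvg_ex [l hl]; exists l.
apply/cauchy_cvgP; apply/cauchyP => _ /posnumP[e].
have [N _ hN] := geometric_eps h0 C0 (gt0 (e%:num / 2)%:pos).
exists (p N).
exists N => // k /= Nk; rewrite /ball /= distrC.
apply: le_lt_trans (hp _ _ Nk) _.
apply: le_lt_trans (hN N (leqnn _)) _ => /=.
by rewrite ltr_pdivrMr // ltr_pMr // ltr1n.
Qed.

Lemma complex_geometrically_complete (R : realType) :
  geometrically_complete (R[i] : numFieldType).
Proof.
pose K : numFieldType := R[i].
have [h0 h1] := real_geometrically_complete R.
have cC (p : R^nat) (l : R) : p @ \oo --> l -> 
    ((fun k => (p k)%:C%C) : K^nat) @ \oo --> (l%:C%C : K).
  move=> /cvgrPdist_lt hp; apply/(@cvgrPdist_lt K K) => e e0.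
  have /andP[/eqP /= ie re] : (complex.Im e == 0) && (0 < complex.Re e).
    by move: e0; rewrite ltcE /=.
  have := hp _ re; apply: filterS => k hk.
  by rewrite -rmorphB /= normc_def /= expr0n /= addr0 sqrtr_sqr ltcE /= ie eqxx.
split.
  have := cC _ _ h0; rewrite (_ : (fun _ => _) = (fun k => 2^-1 ^+ k)) //.
  by apply/funext => k; rewrite rmorphXn /= fmorphV rmorphD.
move=> p C hp.
(* [C] bounds a norm, so it is a nonnegative real; real and imaginary parts then inherit the same
   geometric bound. *)
have iC m : C / 2 ^+ m = (complex.Re C / 2 ^+ m)%:C%C.
  have C0 : 0 <= C by have := hp 0 0 (leqnn _); rewrite subrr normr0 expr0 divr1.
  rewrite -[in LHS](RRe_real (ger0_real C0)).
  by rewrite rmorphM /= fmorphV rmorphXn rmorphD.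
have nIm (z : R[i]) : `|complex.Im z|%:C%C <= `|z|.
  rewrite normc_def lecR -sqrtr_sqr; apply: ler_wsqrtr; by rewrite lerDr sqr_ge0.
have [|a ha] := h1 (fun k => complex.Re (p k)) (complex.Re C).
  move=> m n /hp; rewrite iC => /(le_trans (normc_ge_Re _)); rewrite lecR.
  by case: (p n) (p m) => [? ?] [? ?].
have [|b hb] := h1 (fun k => complex.Im (p k)) (complex.Re C).
  move=> m n /hp; rewrite iC => /(le_trans (nIm _)); rewrite lecR.
  by case: (p n) (p m) => [? ?] [? ?].
exists (a%:C%C + 'i%C * b%:C%C).
rewrite (_ : p = fun k => (complex.Re (p k))%:C%C + 'i%C * (complex.Im (p k))%:C%C); last first.
  by apply/funext => k; rewrite -complexE.
apply: (@cvgD K K); first exact: cC.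
by apply: (@cvgMr K); exact: cC.
Qed.

(** * Weighted l^1 norms of polynomials *)

Section PolyNorm.
Variable K : numFieldType.

(** One interface for the absolute value on K and the weighted norms on K[t] and K[t][s], so that
    the lemmas on [pnorm] serve at both polynomial levels. *)
Record submultiplicative (A : comNzRingType) (N : A -> K) : Prop := Submultiplicative {
  sub_norm0 : N 0 = 0;
  sub_norm1 : N 1 <= 1;
  sub_norm_ge0 : forall a, 0 <= N a;
  sub_normN : forall a, N (- a) = N a;
  sub_normD : forall a b, N (a + b) <= N a + N b;
  sub_normM : forall a b, N (a * b) <= N a * N b }.

Lemma normr_submultiplicative : submultiplicative (Num.norm : K -> K).
Proof.
by split; [exact: normr0|rewrite normr1|exact: normr_ge0|exact: normrN|
  exact: ler_normD|move=> a b; rewrite normrM].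
Qed.

Variables (A : comNzRingType) (N : A -> K) (hN : submultiplicative N).
Implicit Types (p q : {poly A}).

Lemma sub_norm_sum (I : Type) (s : seq I) (P : pred I) (F : I -> A) :
  N (\sum_(i <- s | P i) F i) <= \sum_(i <- s | P i) N (F i).
Proof.
elim/big_rec2: _ => [|i y x _ h]; first by rewrite (sub_norm0 hN).
by apply: le_trans (sub_normD hN _ _) _; rewrite lerD2l.
Qed.

Lemma sub_normX a k : N (a ^+ k) <= N a ^+ k.
Proof.
elim: k => [|k IH]; first exact: (sub_norm1 hN).
rewrite !exprS; apply: le_trans (sub_normM hN _ _) _.
by rewrite ler_wpM2l // (sub_norm_ge0 hN).
Qed.

Lemma sub_norm_prod (I : Type) (s : seq I) (F : I -> A) :
  N (\prod_(i <- s) F i) <= \prod_(i <- s) N (F i).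
Proof.
elim/big_rec2: _ => [|i y x _ h]; first exact: (sub_norm1 hN).
apply: le_trans (sub_normM hN _ _) _.
by rewrite ler_wpM2l // (sub_norm_ge0 hN).
Qed.

Definition pnorm (r : K) p : K := \sum_(i < size p) N p`_i * r ^+ i.

Lemma pnormE r p n : (size p <= n)%N -> pnorm r p = \sum_(i < n) N p`_i * r ^+ i.
Proof.
move=> pn; rewrite /pnorm (big_ord_widen n (fun i => N p`_i * r ^+ i) pn).
rewrite big_mkcond; apply: eq_bigr => i _; case: ltnP => // pi.
by rewrite nth_default // (sub_norm0 hN) mul0r.
Qed.

Lemma pnorm_cons r p c : pnorm r (p * 'X + c%:P) = pnorm r p * r + N c.
Proof.
rewrite (@pnormE r (p * 'X + c%:P) (size p).+1); last first.
  rewrite size_MXaddC; case: ifP => //.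
rewrite big_ord_recl coefD coefMX coefC /= add0r expr0 mulr1 addrC; congr (_ + _).
rewrite /pnorm mulr_suml; apply: eq_bigr => i _.
by rewrite coefD coefMX coefC /= addr0 exprSr mulrA.
Qed.

Lemma pnormC r c : pnorm r c%:P = N c.
Proof. by rewrite -[c%:P]add0r -[0](mul0r 'X) pnorm_cons /pnorm size_poly0 big_ord0 mul0r add0r. Qed.

Lemma pnormMX r p : pnorm r (p * 'X) = pnorm r p * r.
Proof. by rewrite -[_ * _]addr0 -[0]/(0%:P) pnorm_cons (sub_norm0 hN) addr0. Qed.

Lemma pnormMXn r p n : pnorm r (p * 'X^n) = pnorm r p * r ^+ n.
Proof.
elim: n => [|n IH]; first by rewrite !expr0 !mulr1.
by rewrite !exprSr !mulrA pnormMX IH.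
Qed.

Lemma pnormX r : pnorm r 'X <= r * N 1.
Proof. by rewrite -['X]mul1r pnormMX pnormC mulrC. Qed.

Lemma coef_pnorm r p i : 0 <= r -> N p`_i * r ^+ i <= pnorm r p.
Proof.
move=> r0; rewrite (@pnormE r p (maxn i.+1 (size p))) ?leq_maxr //.
have hi : (i < maxn i.+1 (size p))%N by rewrite leq_max ltnSn.
rewrite (bigD1 (Ordinal hi)) //= lerDl sumr_ge0 // => j _.
by rewrite mulr_ge0 ?exprn_ge0 ?(sub_norm_ge0 hN).
Qed.

(** The product bound goes by Horner induction on [p]: multiplying by ['X] scales the norm by
    exactly r, multiplying by a constant c by at most N c, so no convolution of coefficients
    appears. *)
Lemma pnorm_submultiplicative r : 0 <= r -> submultiplicative (pnorm r).
Proof.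
move=> r0.
have ge0 p : 0 <= pnorm r p.
  by apply: sumr_ge0 => i _; rewrite mulr_ge0 ?exprn_ge0 ?(sub_norm_ge0 hN).
have D p q : pnorm r (p + q) <= pnorm r p + pnorm r q.
  rewrite (@pnormE r (p + q) (maxn (size p) (size q))) ?size_polyD //.
  rewrite (pnormE r (leq_maxl (size p) (size q))) (pnormE r (leq_maxr (size p) (size q))).
  rewrite -big_split; apply: ler_sum => i _ /=.
  by rewrite coefD -mulrDl ler_wpM2r ?exprn_ge0 ?(sub_normD hN).
have CM c p : pnorm r (c%:P * p) <= N c * pnorm r p.
  rewrite (@pnormE _ _ (size p)) ?mul_polyC ?size_scale_leq // mulr_sumr.
  apply: ler_sum => i _; rewrite coefZ mulrA.
  by rewrite ler_wpM2r ?exprn_ge0 ?(sub_normM hN).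
split=> //.
- by rewrite -[0]/(0%:P) pnormC (sub_norm0 hN).
- by rewrite pnormC (sub_norm1 hN).
- by move=> p; rewrite /pnorm size_polyN; apply: eq_bigr => i _; rewrite coefN (sub_normN hN).
- move=> p q; elim/poly_ind: p => [|p c IH].
    by rewrite mul0r -[0]/(0%:P) pnormC (sub_norm0 hN) mul0r.
  rewrite mulrDl mulrAC; apply: le_trans (D _ _) _.
  rewrite pnormMX pnorm_cons mulrDl lerD //.
  by rewrite mulrAC ler_wpM2r.
Qed.

Lemma pnorm_ge0 r p : 0 <= r -> 0 <= pnorm r p.
Proof. by move=> r0; exact: (sub_norm_ge0 (pnorm_submultiplicative r0)). Qed.

Lemma pnorm_le r s p : 0 <= r -> r <= s -> pnorm r p <= pnorm s p.
Proof.
move=> r0 rs; apply: ler_sum => i _.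
by rewrite ler_wpM2l ?(sub_norm_ge0 hN) // lerXn2r // nnegrE // (le_trans r0).
Qed.

(** A Schwarz lemma: shrinking the radius gains (r/s)^n. The form without division allows s = 0. *)
Lemma pnorm_dvdXn r s p n : 0 <= r -> r <= s ->
  (exists q, p = q * 'X^n) -> pnorm r p * s ^+ n <= r ^+ n * pnorm s p.
Proof.
move=> r0 rs [q ->]; rewrite !pnormMXn mulrA [r ^+ n * _]mulrC.
by rewrite !ler_wpM2r ?exprn_ge0 ?pnorm_le // (le_trans r0).
Qed.

Lemma norm_horner r p x : 0 <= r -> N x <= r -> N p.[x] <= pnorm r p.
Proof.
move=> r0 xr; elim/poly_ind: p => [|p c IH].
  by rewrite horner0 -[X in pnorm r X]/(0%:P) pnormC.
rewrite hornerMXaddC pnorm_cons; apply: le_trans (sub_normD hN _ _) _.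
rewrite lerD2r; apply: le_trans (sub_normM hN _ _) _.
by apply: ler_pM; rewrite ?(sub_norm_ge0 hN).
Qed.

(** Serves to recentre at t0: for q = X + t0 the condition on [q] follows from r + |t0| <= s. *)
Lemma pnorm_comp r s p q : 0 <= r -> 0 <= s -> pnorm r q <= s ->
  pnorm r (p \Po q) <= pnorm s p.
Proof.
move=> r0 s0 qs; have hr := pnorm_submultiplicative r0.
elim/poly_ind: p => [|p c IH].
  by rewrite comp_poly0 -[0]/(0%:P) !pnormC.
rewrite comp_poly_MXaddC pnorm_cons; apply: le_trans (sub_normD hr _ _) _.
rewrite pnormC lerD2r; apply: le_trans (sub_normM hr _ _) _.
by apply: ler_pM; rewrite ?(sub_norm_ge0 hr).
Qed.

End PolyNorm.

Lemma norm_cvg_le (K : numFieldType) (V : normedModType K) (v : nat -> V) (l : V) (B : K) :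
  v @ \oo --> l -> (\forall n \near \oo, `|v n| <= B) -> `|l| <= B.
Proof.
move=> vl [N _ hB].
have B0 : 0 <= B by apply: le_trans (hB N (leqnn _)).
(* The order of K may be partial; both sides are real, so the negation of [<=] is still [>]. *)
rewrite real_leNgt ?realE ?normr_ge0 ?B0 //; apply/negP => lB.
have e0 : 0 < `|l| - B by rewrite subr_gt0.
have [M _ hM] := (cvgrPdist_lt _ _).1 vl _ e0.
have := hM _ (leq_maxr N M); apply/negP.
rewrite -real_leNgt ?realE ?normr_ge0 ?(ltW e0) //.
rewrite lerBlDr; apply: le_trans (_ : `|l - v (maxn N M)| + `|v (maxn N M)| <= _).
  by rewrite -{1}[l](subrK (v (maxn N M))) ler_normD.
by rewrite lerD2l; apply: hB; exact: leq_maxl.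
Qed.

(** * From Cauchy sequences of polynomials to power series *)

Section Completeness.
Variables (K : numFieldType) (hK : geometrically_complete K).

(** The coefficients of [p n] converge one by one to [a]. For J at least the size of [p M], both the
    limit of the values and the J-th partial sum of the limit series lie within C / 2^M of [(p
    M).[h]]. *)
Lemma pnorm_complete (p : nat -> {poly K}) (r C : K) : 0 < r ->
  (forall m n, (m <= n)%N -> pnorm Num.norm r (p n - p m) <= C / 2 ^+ m) ->
  exists a : nat -> K, forall h, `|h| <= r ->
    exists2 l : K, ((fun n => (p n).[h]) : K^nat) @ \oo --> l &
      series (fun k => a k * h ^+ k) @ \oo --> l.
Proof.
move=> r0 hp; have hN := normr_submultiplicative K.
have C0 : 0 <= C.
  by have := le_trans (pnorm_ge0 hN _ (ltW r0)) (hp 0 0 (leqnn _)); rewrite expr0 divr1.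
have hc k : exists l : K, (fun n => (p n)`_k : K) @ \oo --> l.
  apply: (hK.2 _ (C / r ^+ k)) => m n mn.
  rewrite mulrAC ler_pdivlMr ?exprn_gt0 // -coefB; apply: le_trans (hp _ _ mn).
  by rewrite (coef_pnorm hN) // ltW.
have {hc} [a ha] := choice hc.
exists a => h hr.
have hl m n : (m <= n)%N -> `|(p n).[h] - (p m).[h]| <= C / 2 ^+ m.
  move=> mn; apply: le_trans (hp _ _ mn); rewrite -hornerN -hornerD.
  by rewrite (norm_horner hN) // ltW.
have [l pl] := hK.2 _ _ hl.
exists l => //; apply/cvgrPdist_le => e e0.
have C20 : 0 <= C + C by rewrite addr_ge0.
have [M _ hM] := geometric_eps hK.1 C20 e0.
have := hM M (leqnn _); rewrite mulrDl => {}hM.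
exists (size (p M)) => // J /= pJ.
apply: le_trans hM; apply: le_trans (ler_distD (p M).[h] _ _) _; apply: lerD.
  apply: (@norm_cvg_le K K (fun n => (p n).[h] - (p M).[h])).
    by apply: (@cvgB K K) => //; exact: cvg_cst.
  by exists M => // n /= /hl.
apply: (@norm_cvg_le K K (fun n => (p M).[h] - \sum_(0 <= k < J) (p n)`_k * h ^+ k)).
  apply: (@cvgB K K); first exact: cvg_cst.
  apply: cvg_big; first exact: add_continuous.
  by move=> k _; apply: (@cvgMl K); exact: ha.
exists M => // n /= Mn; rewrite distrC (horner_coef_wide h pJ) big_mkord -sumrB.
apply: le_trans (hp _ _ Mn).
rewrite (@pnormE _ _ _ hN r (p n - p M) (maxn J (size (p n - p M)))) ?leq_maxr //.
rewrite (big_ord_widen _ (fun i => (p n)`_i * h ^+ i - (p M)`_i * h ^+ i) (leq_maxl J (size (p n - p M)))).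
apply: le_trans (ler_norm_sum _ _ _) _; rewrite big_mkcond; apply: ler_sum => i _.
case: ifP => _; last by rewrite mulr_ge0 ?normr_ge0 ?exprn_ge0 ?ltW.
rewrite -mulrBl coefB normrM normrX ler_wpM2l ?normr_ge0 // lerXn2r // nnegrE ?normr_ge0 //.
exact: ltW.
Qed.

End Completeness.

(** * Power series in several variables *)

Lemma entry_norm_le (K : numFieldType) p q (M : 'M[K]_(p, q)) i j : `|M i j| <= `|M|.
Proof.
rewrite {2}/Num.norm /= mx_normE.
rewrite -[leLHS]nngE num_le.
exact: (le_bigmax _ (fun k : 'I_p * 'I_q => `|M k.1 k.2|%:nng) (i, j)).
Qed.

Lemma mx_norm_le (K : numFieldType) p q (M : 'M[K]_(p, q)) (B : K) :
  0 <= B -> (forall i j, `|M i j| <= B) -> `|M| <= B.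
Proof.
move=> B0 hB; rewrite /Num.norm /=.
by have [->//|/mx_norm_neq0 -[i ->]] := eqVneq (mx_norm M) 0.
Qed.

Section PowerSeries.
Variables (K : numFieldType) (n : nat).
Implicit Types (c : multinom n -> K) (g : 'rV[K]_n -> K) (x : 'rV[K]_n).

(** [bmultinom n N] and [bmultinom n N.+1] are distinct types: the lower degrees are reindexed along
    the inclusion [w], with partial inverse [v]. *)
Lemma big_bmultinomS (V : nmodType) (F : multinom n -> V) N :
  \sum_(m : bmultinom n N.+1) F m =
  \sum_(m : bmultinom n N) F m + \sum_(m : bmultinom n N.+1 | mdeg m == N) F m.
Proof.
rewrite (bigID (fun m : bmultinom n N.+1 => (mdeg m == N))) /= addrC; congr (_ + _).
have hw (m : bmultinom n N) : (mdeg m < N.+1)%N by rewrite ltnS ltnW // bmdeg.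
pose w m : bmultinom n N.+1 := BMultinom (hw m).
have ww (m1 m2 : bmultinom n N) : bmnm m1 = bmnm m2 -> m1 = m2 by move=> h; apply/eqP; rewrite bmeqP; apply/eqP.
pose v (m : bmultinom n N.+1) : option (bmultinom n N) := insub (bmnm m).
rewrite (reindex_omap w v) /=; last first.
  move=> m hm; have hN : (mdeg m < N)%N by rewrite ltn_neqAle hm -ltnS bmdeg.
  rewrite /v insubT /=; congr Some; apply/eqP; rewrite bmeqP //.
apply: eq_bigl => m; rewrite /v /=; rewrite (_ : mdeg m != N) ?ltn_eqF ?bmdeg //=.
by rewrite /w insubT ?bmdeg //= => h; apply/eqP; congr Some; apply: ww.
Qed.

(** Reduces convergence in several variables to that of the one-variable series with terms
    [homog_bound c j * d ^+ j]. *)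
Definition homog_bound c j : K := \sum_(m : bmultinom n j.+1 | mdeg m == j) `|c m|.

Lemma homog_bound_ge0 c j : 0 <= homog_bound c j.
Proof. by apply: sumr_ge0. Qed.

Lemma mmap_homog_part (A : comNzRingType) (h : {rmorphism K -> A}) (v : 'I_n -> A) c j :
  mmap h v (homog_part c j) =
  \sum_(m : bmultinom n j.+1 | mdeg m == j) h (c m) * mmap1 v m.
Proof.
rewrite /homog_part (raddf_sum (mmap h v)); apply: eq_bigr => m _.
by rewrite /= mmapZ mmapX.
Qed.

Lemma prod_expr_mdeg (A : comNzRingType) (a : A) (m : multinom n) j :
  mdeg m == j -> a ^+ j = \prod_(i < n) a ^+ m i.
Proof. by move=> /eqP <-; rewrite mdegE prodrXr. Qed.

Lemma mmap_homog_partZ (A : comNzRingType) (h : {rmorphism K -> A}) (v : 'I_n -> A) c j a :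
  mmap h (fun i => a * v i) (homog_part c j) = a ^+ j * mmap h v (homog_part c j).
Proof.
rewrite !mmap_homog_part mulr_sumr; apply: eq_bigr => m mj.
rewrite mulrCA; congr (_ * _); rewrite (prod_expr_mdeg _ mj) /mmap1 -big_split.
by apply: eq_bigr => i _; rewrite exprMn.
Qed.

(** The target ring is arbitrary because the bound is applied both to values in K and to
    substitutions of bivariate polynomials. *)
Lemma mmap_homog_part_le (A : comNzRingType) (N : A -> K) (hN : submultiplicative N)
    (h : {rmorphism K -> A}) (v : 'I_n -> A) c j (B : K) :
  (forall a, N (h a) <= `|a|) -> (forall i, N (v i) <= B) ->
  N (mmap h v (homog_part c j)) <= homog_bound c j * B ^+ j.
Proof.
move=> hh hv; rewrite mmap_homog_part mulr_suml.
apply: le_trans (sub_norm_sum hN _ _ _) _; apply: ler_sum => m mj.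
apply: le_trans (sub_normM hN _ _) _.
apply: ler_pM; rewrite ?(sub_norm_ge0 hN) //.
rewrite (prod_expr_mdeg _ mj) /mmap1; apply: le_trans (sub_norm_prod hN _ _) _.
apply: ler_prod => i _; rewrite (sub_norm_ge0 hN) /=.
apply: le_trans (sub_normX hN _ _) _; rewrite lerXn2r // ?nnegrE ?(sub_norm_ge0 hN) //.
by apply: le_trans (hv i); rewrite (sub_norm_ge0 hN).
Qed.

Lemma eval_homog_part_le c j x (B : K) : `|x| <= B ->
  `|eval (homog_part c j) x| <= homog_bound c j * B ^+ j.
Proof.
move=> xB; apply: (mmap_homog_part_le (normr_submultiplicative K)) => // i.
by apply: le_trans xB; exact: entry_norm_le.
Qed.

Lemma eval_homog_partZ c j x (t : K) :
  eval (homog_part c j) (t *: x) = t ^+ j * eval (homog_part c j) x.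
Proof.
rewrite /Defs.eval /meval -mmap_homog_partZ; apply: meval_eq => i.
by rewrite mxE.
Qed.

Lemma sum_monomial c x N :
  \sum_(m : bmultinom n N) c m * monomial x m = \sum_(j < N) eval (homog_part c j) x.
Proof.
elim: N => [|N IH].
  rewrite big_ord0 big1 // => m _; have := bmdeg m; by rewrite ltn0.
rewrite (big_bmultinomS (fun m => c m * monomial x m)) big_ord_recr /= IH; congr (_ + _).
by rewrite /Defs.eval /meval mmap_homog_part.
Qed.

Lemma sum_norm_monomial c (d : K) N : 0 <= d ->
  \sum_(m : bmultinom n N) `|c m * monomial (const_mx d) m| =
  \sum_(j < N) homog_bound c j * d ^+ j.
Proof.
move=> d0; elim: N => [|N IH].
  rewrite big_ord0 big1 // => m _; have := bmdeg m; by rewrite ltn0.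
rewrite (big_bmultinomS (fun m => `|c m * monomial (const_mx d) m|)) big_ord_recr /= IH.
congr (_ + _); rewrite mulr_suml; apply: eq_bigr => m mj.
rewrite normrM; congr (_ * _); rewrite /monomial normr_prod (prod_expr_mdeg _ mj).
by apply: eq_bigr => i _; rewrite mxE normrX ger0_norm.
Qed.

Lemma power_series_bound g c : has_power_series g 0 c ->
  exists (d S : K), 0 < d /\ (forall N, \sum_(j < N) homog_bound c j * d ^+ j <= S) /\
  forall x, `|x| <= d ->
    ((fun N => \sum_(j < N) eval (homog_part c j) x) : K^nat) @ \oo --> g x.
Proof.
move=> /nbhs_norm0P [e /= e0 he].
pose d := e / 2; have d0 : 0 < d by rewrite divr_gt0.
have de : d < e by rewrite ltr_pdivrMr // ltr_pMr // ltr1n.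
exists d.
(* At the vector with all coordinates d, each monomial has norm d to its degree, so absolute
   convergence there is convergence of the majorant series. *)
have [|/cvg_ex [l hl] _] := he (const_mx d).
  by rewrite /=; apply: le_lt_trans de; apply: mx_norm_le => [|i j]; rewrite ?mxE ?ger0_norm // ltW.
have {}hl : (fun N => \sum_(j < N) homog_bound c j * d ^+ j : K) @ \oo --> l.
  by move: hl; rewrite (funext (fun N => sum_norm_monomial c N (ltW d0))).
have [M _ hM] := (cvgrPdist_le _ _).1 hl _ ltr01.
(* From index M on, the partial sums are within 1 of [l]; earlier ones are smaller since the terms
   are nonnegative. *)
exists (1 + `|l|); split=> //; split=> [N|x xd].
  have term0 j : 0 <= homog_bound c j * d ^+ j.
    by rewrite mulr_ge0 ?homog_bound_ge0 // exprn_ge0 // ltW.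
  apply: (@le_trans _ _ (\sum_(j < maxn M N) homog_bound c j * d ^+ j)).
    rewrite (big_ord_widen _ (fun j => homog_bound c j * d ^+ j) (leq_maxr M N)).
    by rewrite big_mkcond; apply: ler_sum => j _; case: ifP.
  have := hM _ (leq_maxl M N); rewrite /= distrC => h.
  rewrite -[leLHS]ger0_norm ?sumr_ge0 // -[X in `|X|](subrK l).
  by apply: le_trans (ler_normD _ _) _; rewrite lerD2r.
have [|_ ] := he x; first exact: le_lt_trans xd de.
by rewrite add0r (funext (sum_monomial c x)).
Qed.

(** A term of degree j >= N is at most [homog_bound c j * d ^+ j] times (r/d)^j, and (r/d)^j <=
    (r/d)^N because r <= d. The bound on finite sums passes to the limit. *)
Lemma power_series_tail g c (d S : K) : 0 < d ->
  (forall N, \sum_(j < N) homog_bound c j * d ^+ j <= S) ->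
  forall x (r : K) N, `|x| <= r -> r <= d ->
    ((fun N => \sum_(j < N) eval (homog_part c j) x) : K^nat) @ \oo --> g x ->
  `|g x - \sum_(j < N) eval (homog_part c j) x| <= S * (r / d) ^+ N.
Proof.
move=> d0 hS x r N xr rd hg; have r0 : 0 <= r by apply: le_trans xr.
apply: (@norm_cvg_le K K
  (fun M => \sum_(j < M) eval (homog_part c j) x - \sum_(j < N) eval (homog_part c j) x)).
  by apply: (@cvgB K K) => //; exact: cvg_cst.
exists N => // M /= NM.
have rd0 : 0 <= r / d by rewrite divr_ge0 // ltW.
have rd1 : r / d <= 1 by rewrite ler_pdivrMr // mul1r.
have -> : \sum_(j < M) eval (homog_part c j) x - \sum_(j < N) eval (homog_part c j) x =
    \sum_(j < M | (N <= j)%N) eval (homog_part c j) x.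
  rewrite (big_ord_widen _ (fun j => eval (homog_part c j) x) NM).

  rewrite (bigID (fun j : 'I_M => (j < N)%N)) /= addrAC subrr add0r.
  by apply: eq_bigl => j; rewrite -leqNgt.
apply: le_trans (ler_norm_sum _ _ _) _.
apply: (@le_trans _ _ (\sum_(j < M) homog_bound c j * d ^+ j * (r / d) ^+ N)).
  rewrite big_mkcond; apply: ler_sum => j _; case: ifP => Nj; last first.
    by rewrite !mulr_ge0 ?homog_bound_ge0 ?exprn_ge0 ?(ltW d0).
  apply: le_trans (eval_homog_part_le _ _ xr) _.
  rewrite -mulrA ler_wpM2l ?homog_bound_ge0 //.
  rewrite -{1}[r](divfK (lt0r_neq0 d0)) exprMn mulrC ler_wpM2l ?exprn_ge0 ?(ltW d0) //.
  exact: ler_wiXn2l.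
by rewrite -mulr_suml ler_wpM2r ?exprn_ge0.
Qed.

End PowerSeries.

(** * Limits and difference quotients of polynomials *)

Lemma squeeze_cvg0 (K : numFieldType) (v a : K^nat) :
  (\forall k \near \oo, `|v k| <= a k) -> a @ \oo --> (0 : K) -> v @ \oo --> (0 : K).
Proof.
move=> va a0; apply/cvgrPdist_lt => e e0.
move/cvgrPdist_lt : a0 => /(_ _ e0); move: va; apply: filterS2 => k vk.
rewrite !sub0r !normrN; apply: le_lt_trans; apply: le_trans (vk) _.
by apply: real_ler_norm; rewrite ger0_real // (le_trans _ vk).
Qed.

Section MPolyInduction.
Variables (K : comNzRingType) (n : nat) (P : mpoly n K -> Prop).
Hypotheses (PC : forall a, P (mpolyC n a)) (PX : forall i, P (mpolyX K (mnm1 i))).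
Hypotheses (PD : forall p q, P p -> P q -> P (p + q)).
Hypotheses (PM : forall p q, P p -> P q -> P (p * q)).

(** Limits, difference quotients, Taylor expansions and substitutions are all compatible with sums
    and products, so this induction spares any computation with monomials. *)
Lemma mpoly_ring_ind p : P p.
Proof.
have P0 : P 0 by rewrite -(mpolyC0 n K).
have P1 : P 1 by rewrite -(mpolyC1 n K).
elim/mpolyind: p => // a m p _ _ Pp; apply: PD => //.
rewrite -mul_mpolyC; apply: PM; first exact: PC.
rewrite mpolyXE_id; apply: (big_ind P) => // i _.
by elim: (m i) => [|k IH]; rewrite ?expr0 ?exprS //; apply: PM.
Qed.

End MPolyInduction.

Section Limits.
Variables (K : numFieldType) (n : nat).
Implicit Types (c : multinom n -> K) (g : 'rV[K]_n -> K) (x : 'rV[K]_n).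

Lemma cvg_coord (x_ : nat -> 'rV[K]_n) x i :
  x_ @ \oo --> x -> (fun k => x_ k 0 i : K) @ \oo --> x 0 i.
Proof.
move=> /cvgrPdist_lt hx; apply/cvgrPdist_lt => e /hx; apply: filterS => k.
by apply: le_lt_trans; have := entry_norm_le (x - x_ k) 0 i; rewrite !mxE.
Qed.

Lemma cvg_eval (p : mpoly n K) (x_ : nat -> 'rV[K]_n) x :
  x_ @ \oo --> x -> (fun k => eval p (x_ k) : K) @ \oo --> eval p x.
Proof.
move=> hx; elim/mpoly_ring_ind: p => [a|i|p q hp hq|p q hp hq]; rewrite /Defs.eval.
- rewrite (_ : (fun _ => _) = cst a); first by rewrite mevalC; exact: cvg_cst.
  by apply/funext => k; rewrite mevalC.
- rewrite (_ : (fun _ => _) = (fun k => x_ k 0 i)).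
    by rewrite mevalXU; exact: cvg_coord.
  by apply/funext => k; rewrite mevalXU.
- rewrite (_ : (fun _ => _) = (fun k => eval p (x_ k) + eval q (x_ k))).
    by rewrite mevalD; exact: (@cvgD K K).
  by apply/funext => k; rewrite mevalD.
- rewrite (_ : (fun _ => _) = (fun k => eval p (x_ k) * eval q (x_ k))).
    by rewrite mevalM; exact: (@cvgM K).
  by apply/funext => k; rewrite mevalM.
Qed.

Lemma pairingDl (a b y : 'rV[K]_n) : pairing (a + b) y = pairing a y + pairing b y.
Proof. by rewrite /pairing -big_split; apply: eq_bigr => i _; rewrite mxE mulrDl. Qed.

Lemma pairingZl s (a y : 'rV[K]_n) : pairing (s *: a) y = s * pairing a y.
Proof. by rewrite /pairing mulr_sumr; apply: eq_bigr => i _; rewrite mxE mulrA. Qed.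

Lemma pairingZr s (a y : 'rV[K]_n) : pairing a (s *: y) = s * pairing a y.
Proof. by rewrite /pairing mulr_sumr; apply: eq_bigr => i _; rewrite mxE mulrCA. Qed.

Lemma gradC a x : grad (mpolyC n a) x = 0.
Proof. by apply/rowP => i; rewrite !mxE mderivC /Defs.eval meval0. Qed.

Lemma gradX i x : grad (mpolyX K (mnm1 i)) x = delta_mx 0 i.
Proof.
apply/rowP => j; rewrite !mxE mderivX mnm1E /Defs.eval eqxx /= eq_sym.
have [->|_] := eqVneq j i; last by rewrite scale0r meval0.
have -> : mnm_sub (mnm1 i) (mnm1 i) = mnm0 by apply/mnmP => k; rewrite mnmBE subnn mnm0E.
by rewrite scale1r mpolyX0 meval1.
Qed.

Lemma gradD (p q : mpoly n K) x : grad (p + q) x = grad p x + grad q x.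
Proof. by apply/rowP => i; rewrite !mxE mderivD /Defs.eval mevalD. Qed.

Lemma gradM (p q : mpoly n K) x : grad (p * q) x = eval p x *: grad q x + eval q x *: grad p x.
Proof.
apply/rowP => i; rewrite !mxE mderivM /Defs.eval mevalD !mevalM.
by rewrite addrC [_ * meval _ q]mulrC.
Qed.

Lemma pairing_delta i (y : 'rV[K]_n) : pairing (delta_mx 0 i) y = y 0 i.
Proof.
rewrite /pairing (bigD1 i) //= mxE !eqxx mul1r big1 ?addr0 // => j ji.
by rewrite mxE (negPf ji) andbF mul0r.
Qed.

(** The direction varies with k, as it does for the points of the second-order tangent set. *)
Lemma cvg_eval_grad (p : mpoly n K) (u y : 'rV[K]_n) (t : K^nat) (y_ : nat -> 'rV[K]_n) :
  (forall k, t k != 0) -> t @ \oo --> (0 : K) -> y_ @ \oo --> y ->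
  (fun k => (t k)^-1 * (eval p (u + t k *: y_ k) - eval p u) : K) @ \oo --> pairing (grad p u) y.
Proof.
move=> tn0 t0 hy.
have hx : (fun k => u + t k *: y_ k) @ \oo --> u.
  rewrite -[X in _ --> X]addr0 -[X in _ + X](scale0r y).
  by apply: cvgD; [exact: cvg_cst|exact: cvgZ].
elim/mpoly_ring_ind: p => [a|i|p q hp hq|p q hp hq].
- have -> : pairing (grad (mpolyC n a) u) y = 0.
    by rewrite gradC /pairing big1 // => i _; rewrite mxE mul0r.
  under eq_fun => k do rewrite /Defs.eval !mevalC subrr mulr0.
  exact: cvg_cst.
- rewrite gradX pairing_delta (_ : (fun _ => _) = (fun k => y_ k 0 i)).
    by exact: cvg_coord.
  by apply/funext => k; rewrite /Defs.eval !mevalXU !mxE [u 0 i + _]addrC addrK mulrA mulVf // mul1r.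
- have -> : (fun k => (t k)^-1 * (eval (p + q) (u + t k *: y_ k) - eval (p + q) u)) =
      (fun k => (t k)^-1 * (eval p (u + t k *: y_ k) - eval p u) +
                (t k)^-1 * (eval q (u + t k *: y_ k) - eval q u)).
    by apply/funext => k /=; rewrite /Defs.eval !mevalD opprD addrACA mulrDr.
  by rewrite gradD pairingDl; exact: (@cvgD K K _ _ _ _ _ _ _ hp hq).
(* Leibniz rule from a b - a' b' = a (b - b') + b' (a - a'). *)
- have -> : (fun k => (t k)^-1 * (eval (p * q) (u + t k *: y_ k) - eval (p * q) u)) =
      (fun k => eval p (u + t k *: y_ k) * ((t k)^-1 * (eval q (u + t k *: y_ k) - eval q u)) +
                eval q u * ((t k)^-1 * (eval p (u + t k *: y_ k) - eval p u))).
    apply/funext => k /=; rewrite /Defs.eval !mevalM.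
    move: (meval _ p) (meval _ q) (meval (u 0) p) (meval (u 0) q) => a b a' b'.
    rewrite (mulrCA a) (mulrCA b') -mulrDr; congr (_ * _).
    by rewrite !mulrBr [b' * a]mulrC addrA subrK [b' * a']mulrC.
  rewrite gradM pairingDl !pairingZl.
  apply: (@cvgD K K); first by apply: (@cvgM K) => //; exact: cvg_eval hx.
  by apply: (@cvgMr K).
Qed.

End Limits.

(** * Second-order tangent sets *)

Lemma seq_limit_unique (K : numFieldType) (v : K^nat) (a b : K) :
  v @ \oo --> a -> v @ \oo --> b -> a = b.
Proof. by move=> ha hb; apply: (cvg_unique _ ha hb); exact: norm_hausdorff. Qed.

Lemma cvg_expn (K : numFieldType) (v : K^nat) (a : K) e :
  v @ \oo --> a -> (fun k => v k ^+ e : K) @ \oo --> a ^+ e.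
Proof.
move=> va; elim: e => [|e IH].
  by under eq_fun do rewrite expr0; exact: cvg_cst.
by under eq_fun do rewrite exprS; rewrite exprS; exact: (@cvgM K).
Qed.

Section TangentSets.
Variables (K : numFieldType) (n : nat).
Implicit Types (c : multinom n -> K) (g : 'rV[K]_n -> K) (x : 'rV[K]_n) (X : set 'rV[K]_n).

Lemma near_seq (T : topologicalType) (a : T) (P : T -> Prop) (x_ : nat -> T) :
  x_ @ \oo --> a -> (\forall x \near a, P x) -> \forall k \near \oo, P (x_ k).
Proof. by move=> h; apply: h. Qed.

(* The inequality of [power_series_tail] at [t k *: y k], homogenized. *)
Lemma initial_form_estimate X g c (e : nat) (t : K^nat) (y_ : nat -> 'rV[K]_n)
    (y : 'rV[K]_n) :
  has_power_series g 0 c -> (\forall x \near (0 : 'rV[K]_n), X x -> g x = 0) ->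
  (forall k, 0 < t k) -> y_ @ \oo --> y -> (fun k => t k *: y_ k) @ \oo --> (0 : 'rV[K]_n) ->
  (forall k, X (t k *: y_ k)) ->
  exists2 C : K, 0 <= C & \forall k \near \oo,
    `|\sum_(j < e) t k ^+ j * eval (homog_part c j) (y_ k)| <= C * (t k ^+ e * `|y_ k| ^+ e).
Proof.
move=> gc gX tp hy hx hX; have [r [S [r0 [hS hg]]]] := power_series_bound gc.
have S0 : 0 <= S by have := hS 0%N; rewrite big_ord0.
exists (S / r ^+ e); first by rewrite divr_ge0 // exprn_ge0 // ltW.
have gX' := near_seq hx gX.
have := near_seq hx (nbhs0_le r0); move: gX'; apply: filterS2 => k gk xk.
have := power_series_tail r0 hS e (lexx _) xk (hg _ xk).
rewrite gk // sub0r normrN normrZ gtr0_norm ?tp // !exprMn exprVn.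
under eq_bigr => j _ do rewrite eval_homog_partZ.
by move=> h; apply: le_trans h _; rewrite [leRHS]mulrAC mulrA.
Qed.

(** The estimate is used with scale 1/t_k and direction t_k x_k -> u. Dividing it by t_k^(-d) bounds
    g_d(t_k x_k) by C |t_k x_k|^d |x_k|, which tends to 0. *)
Lemma initial_form_tangent_cone X g c d u : vanishing_ideal X g ->
  has_power_series g 0 c -> initial_degree c d -> tangent_cone X u ->
  eval (homog_part c d) u = 0.
Proof.
move=> [_ gX] gc gd [x [t [hX tp x0 hu]]].
have tn k : t k != 0 by rewrite gt_eqF.
have tx k : (t k)^-1 *: (t k *: x k) = x k by rewrite scalerA mulVf // scale1r.
have [|||C C0 hC] := @initial_form_estimate X g c d.+1 (fun k => (t k)^-1)
    (fun k => t k *: x k) u gc gX _ hu.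
- by move=> k; rewrite invr_gt0.
- by rewrite (funext tx).
- by move=> k; rewrite tx; case: (hX k).
apply: (seq_limit_unique (cvg_eval hu)).
apply: (@squeeze_cvg0 _ _ (fun k => C * (`|t k *: x k| ^+ d * `|x k|))); last first.
  rewrite -(mulr0 C) -(mulr0 (`|u| ^+ d)); apply: (@cvgMr K); apply: (@cvgM K).
    by apply: cvg_expn; exact: cvg_norm.
  by rewrite -[X in _ --> X](@normr0 _ 'rV[K]_n); exact: cvg_norm.
move: hC; apply: filterS => k.
rewrite big_ord_recr /= big1 ?add0r; last first.
  by move=> j _; rewrite gd.1 // /Defs.eval meval0 mulr0.
rewrite normrM normrX ger0_norm ?invr_ge0 ?(ltW (tp k)) // => h.
have td0 : 0 < (t k)^-1 ^+ d by rewrite exprn_gt0 ?invr_gt0.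
rewrite -(ler_pM2l td0); apply: le_trans h _.
rewrite exprSr [`|t k *: x k| ^+ d.+1]exprSr {2}normrZ gtr0_norm //.
rewrite [leRHS]mulrCA ler_wpM2l // -mulrA ler_wpM2l ?(ltW td0) //.
by rewrite [leLHS]mulrCA ler_wpM2l ?exprn_ge0 // mulrA mulVf // mul1r.
Qed.

(** With y_k = u + t_k w_k / 2 the points are t_k y_k. The estimate of order d + 2, divided by
    t_k^d, reads g_d(y_k) + t_k g_(d+1)(y_k) = O(t_k^2). Its limit gives g_d(u) = 0, and a further
    division by t_k gives the equation for w. *)
Lemma second_tangent_set_sub X u :
  second_tangent_set X u `<=` algebraic_second_tangent_set X u.
Proof.
move=> w [t [w_ [tp [_ t0] hw hX]]] g c d [_ gX] gc gd.
have tn k : t k != 0 by rewrite gt_eqF.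
pose z k := 2^-1 *: w_ k; pose y k := u + t k *: z k.
have hz : z @ \oo --> 2^-1 *: w by apply: cvgZr.
have hy : y @ \oo --> u.
  rewrite -[X in _ --> X]addr0 -[X in _ + X](scale0r (2^-1 *: w)).
  by apply: cvgD; [exact: cvg_cst|exact: cvgZ].
have xE k : t k *: y k = t k *: u + (2^-1 * t k ^+ 2) *: w_ k.
  by rewrite /y /z scalerDr !scalerA expr2 [2^-1 * _]mulrC.
have hx : (fun k => t k *: y k) @ \oo --> (0 : 'rV[K]_n).
  by rewrite -[X in _ --> X](scale0r u); exact: cvgZ.
have [|C C0 hC] := initial_form_estimate d.+2 gc gX tp hy hx.
  by move=> k; rewrite xE.
have {hC} est : \forall k \near \oo,
    `|eval (homog_part c d) (y k) + t k * eval (homog_part c d.+1) (y k)| <=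
    C * `|y k| ^+ d.+2 * t k ^+ 2.
  move: hC; apply: filterS => k; rewrite !big_ord_recr /= big1 ?add0r; last first.
    by move=> j _; rewrite gd.1 // /Defs.eval meval0 mulr0.
  have td0 : 0 < t k ^+ d by rewrite exprn_gt0.
  rewrite exprSr -mulrA -mulrDr normrM gtr0_norm // => h.
  rewrite -(ler_pM2l td0); apply: le_trans h _.
  have -> : t k ^+ d.+2 = t k ^+ d * t k ^+ 2 by rewrite -exprD addn2.
  by move: (t k ^+ d) (t k ^+ 2) (`|y k| ^+ d.+2) => p q r; rewrite [leRHS](_ : _ = C * (p * q * r)) //; ring.
have hyd : (fun k => C * `|y k| ^+ d.+2 : K) @ \oo --> C * `|u| ^+ d.+2.
  by apply: (@cvgMr K); apply: cvg_expn; exact: cvg_norm.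
have gu0 : eval (homog_part c d) u = 0.
  apply: (seq_limit_unique (v := fun k => eval (homog_part c d) (y k) +
      t k * eval (homog_part c d.+1) (y k))).
    rewrite -[X in _ --> X]addr0 -(mul0r (eval (homog_part c d.+1) u)).
    by apply: (@cvgD K K); [exact: cvg_eval|apply: (@cvgM K) => //; exact: cvg_eval].
  apply: squeeze_cvg0 est _.
  have -> : 0 = C * `|u| ^+ d.+2 * 0 ^+ 2 by rewrite expr0n mulr0.
  by apply: (@cvgM K) => //; exact: cvg_expn.
rewrite -pairingZr.
apply: (seq_limit_unique (v := fun k =>
    (t k)^-1 * (eval (homog_part c d) (y k) - eval (homog_part c d) u) +
    eval (homog_part c d.+1) (y k))).
  by apply: (@cvgD K K); [exact: cvg_eval_grad|exact: cvg_eval].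
apply: (@squeeze_cvg0 _ _ (fun k => C * `|y k| ^+ d.+2 * t k)); last first.
  by rewrite -(mulr0 (C * `|u| ^+ d.+2)); exact: (@cvgM K).
move: est; apply: filterS => k h.
rewrite -(ler_pM2l (tp k)) -{1}[t k]gtr0_norm // -normrM mulrDr gu0 subr0 mulVKf //.
by apply: le_trans h _; rewrite mulrCA mulrA.
Qed.

End TangentSets.

(** * Solving the implicit equation *)

Lemma pnorm_mono (K : numFieldType) (A : comNzRingType) (N N' : A -> K) r (p : {poly A}) :
  0 <= r -> (forall a, N a <= N' a) -> pnorm N r p <= pnorm N' r p.
Proof. by move=> r0 h; apply: ler_sum => i _; rewrite ler_wpM2r ?exprn_ge0. Qed.

(** Makes the fixed-point iteration contract t-adically: a power of t dividing a - b also divides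
    p(a) - p(b). *)
Lemma horner_sub_dvd (A : comNzRingType) (p : {poly A}) (a b : A) :
  exists q, p.[a] - p.[b] = q * (a - b).
Proof.
elim/poly_ind: p => [|p c [q hq]]; first by exists 0; rewrite !horner0 subrr mul0r.
exists (p.[a] + q * b); rewrite !hornerMXaddC.
have -> : p.[a] = p.[b] + q * (a - b) by rewrite -hq addrC subrK.
by ring.
Qed.

(** Taylor expansion as a ring identity: with [t] a polynomial variable, the explicit factor t^2 of
    the remainder replaces an estimate. *)
Lemma mpoly_taylor (K A : comNzRingType) (n : nat) (h : {rmorphism K -> A})
    (u : 'I_n -> K) (t : A) (y : 'I_n -> A) (p : mpoly n K) :
  exists r, mmap h (fun i => h (u i) + t * y i) p =
    h (meval u p) + t * (\sum_(i < n) h (meval u (mderiv i p)) * y i) + t ^+ 2 * r.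
Proof.
elim/mpoly_ring_ind: p => [a|j|p q [r hr] [s hs]|p q [r hr] [s hs]].
- exists 0; rewrite mmapC mevalC mulr0 addr0 big1 ?mulr0 ?addr0 // => i _.
  by rewrite mderivC meval0 rmorph0 mul0r.
- exists 0; rewrite mmapX mmap1U mevalXU mulr0 addr0; congr (_ + t * _).
  rewrite (bigD1 j) //= big1 => [|i ij]; rewrite mderivX mnm1E.
    have -> : mnm_sub (mnm1 j) (mnm1 j) = mnm0 by apply/mnmP => k; rewrite mnmBE subnn mnm0E.
    by rewrite eqxx scale1r mpolyX0 meval1 rmorph1 mul1r addr0.
  by rewrite eq_sym (negPf ij) scale0r meval0 rmorph0 mul0r.
- set Dp := \sum_(i < n) h (meval u (mderiv i p)) * y i in hr.
  set Dq := \sum_(i < n) h (meval u (mderiv i q)) * y i in hs.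
  exists (r + s); rewrite mmapD hr hs mevalD rmorphD.
  have -> : \sum_(i < n) h (meval u (mderiv i (p + q))) * y i = Dp + Dq.
    rewrite /Dp /Dq -big_split /=; apply: eq_bigr => i _.
    by rewrite mderivD mevalD rmorphD mulrDl.
  move: Dp Dq (h _) (h _) {hr hs} => a b a' b'; ring.
- set Dp := \sum_(i < n) h (meval u (mderiv i p)) * y i in hr.
  set Dq := \sum_(i < n) h (meval u (mderiv i q)) * y i in hs.
  (* All terms of the product of the two expansions that carry t^2. *)
  exists (Dp * Dq + h (meval u p) * s + r * h (meval u q) + t * (Dp * s + r * Dq) + t ^+ 2 * (r * s)).
  rewrite rmorphM /= hr hs mevalM rmorphM.
  have -> : \sum_(i < n) h (meval u (mderiv i (p * q))) * y i =
      h (meval u q) * Dp + h (meval u p) * Dq.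
    rewrite /Dp /Dq !mulr_sumr -big_split /=; apply: eq_bigr => i _.
    rewrite mderivM mevalD !mevalM rmorphD !rmorphM.
    by move: (h _) (h _) (h _) (h _) => a b a' b'; ring.
  move: Dp Dq (h _) (h _) {hr hs} => a b a' b'; ring.
Qed.

Lemma rmorph_mmap (K A : comNzRingType) (n : nat) (h : {rmorphism K -> A})
    (psi : {rmorphism A -> K}) (v : 'I_n -> A) (p : mpoly n K) :
  (forall a, psi (h a) = a) -> psi (mmap h v p) = meval (fun i => psi (v i)) p.
Proof.
move=> hpsi; elim/mpoly_ring_ind: p => [a|j|p q hp hq|p q hp hq].
- by rewrite mmapC mevalC hpsi.
- by rewrite mmapX mmap1U mevalXU.
- by rewrite mmapD mevalD rmorphD hp hq.
- by rewrite rmorphM /= rmorphM hp hq mevalM.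
Qed.

Section ImplicitSeries.
Variable K : numFieldType.

(* In {poly {poly K}} the inner variable is t, of radius r, and the outer one is
   s, of radius 1. *)
Definition pnorm1 (r : K) : {poly K} -> K := pnorm Num.norm r.
Definition pnorm2 (r : K) : {poly {poly K}} -> K := pnorm (pnorm1 r) 1.

Lemma pnorm1_submultiplicative r : 0 <= r -> submultiplicative (pnorm1 r).
Proof. by move=> r0; exact: (pnorm_submultiplicative (normr_submultiplicative K)). Qed.

Lemma pnorm2_submultiplicative r : 0 <= r -> submultiplicative (pnorm2 r).
Proof. by move=> r0; exact: (pnorm_submultiplicative (pnorm1_submultiplicative r0) ler01). Qed.

Lemma pnorm1_le r s p : 0 <= r -> r <= s -> pnorm1 r p <= pnorm1 s p.
Proof. exact: (pnorm_le (normr_submultiplicative K)). Qed.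

(* The fixed point of [s |-> t * (P_0(t,s) + P_1(t,s) + ...)] as a limit of
   polynomials in t; the factor [t ^ j] of P_j makes the iterates stabilize
   coefficientwise, so that their norm bound alone yields convergence at
   smaller radii. *)
Fixpoint implicit_iter (P : nat -> {poly {poly K}}) (k : nat) : {poly K} :=
  if k is k'.+1 then 'X * \sum_(j < k) (P j).[implicit_iter P k'] else 0.

Variables (P : nat -> {poly {poly K}}) (r0 M : K).
Hypotheses (r0_gt0 : 0 < r0) (P_bound : forall N, \sum_(j < N) pnorm2 r0 (P j) <= M).
Hypothesis P_dvd : forall j, exists Q, P j = Q * ('X^j)%:P.

Notation s := (implicit_iter P).

(** By induction: the old terms change by a multiple of t^(k+1), the new term [P k.+1] is divisible
    by t^(k+1), and the outer factor t adds one more power. *)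
Lemma implicit_iter_dvd k : exists q, s k.+1 - s k = q * 'X^(k.+1).
Proof.
elim: k => [|k [q hq]].
  by exists ((P 0%N).[0]); rewrite /= subr0 big_ord1 mulrC.
have diff (j : 'I_k.+1) : exists b, (P j).[s k.+1] - (P j).[s k] = b * 'X^(k.+1).
  by have [b hb] := horner_sub_dvd (P j) (s k.+1) (s k); exists (b * q); rewrite hb hq mulrA.
have [b hb] := choice diff.
have [Q hQ] := P_dvd k.+1.
exists (\sum_(j < k.+1) b j + Q.[s k.+1]).
rewrite [s k.+2]/= -/(s k.+1) big_ord_recr /= -/(s k.+1) hQ hornerM hornerC.
rewrite [X in _ - X](_ : _ = 'X * \sum_(j < k.+1) (P j).[s k]) //.
by rewrite -mulrBr addrAC -sumrB (eq_bigr _ (fun j _ => hb j)) -mulr_suml -mulrDl mulrCA -exprS.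
Qed.

Lemma implicit_iter_dvdX k : exists q, s k = q * 'X.
Proof. by case: k => [|k]; [exists 0; rewrite mul0r|eexists; rewrite /= mulrC; reflexivity]. Qed.

(** Chosen so that e <= r0 and e M <= 1: the iteration then preserves the unit ball of
    [pnorm1 e]. *)
Definition implicit_radius : K := r0 / (1 + M * r0).

Let M_ge0 : 0 <= M.
Proof. by have := P_bound 0; rewrite big_ord0. Qed.

Let den_gt0 : 0 < 1 + M * r0.
Proof. by rewrite ltr_pwDl // mulr_ge0 // ltW. Qed.

Lemma implicit_radius_gt0 : 0 < implicit_radius.
Proof. exact: divr_gt0. Qed.

Lemma implicit_radius_le : implicit_radius <= r0.
Proof. by rewrite ler_pdivrMr // ler_pMr // lerDl mulr_ge0 // ltW. Qed.

Notation e := implicit_radius.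

Lemma implicit_iter_norm k : pnorm1 e (s k) <= 1.
Proof.
have e0 := ltW implicit_radius_gt0; have he := pnorm1_submultiplicative e0.
elim: k => [|k IH]; first by rewrite (sub_norm0 he).
apply: le_trans (sub_normM he _ _) _.
have eM : e * M <= 1.
  by rewrite mulrAC ler_pdivrMr // mul1r mulrC lerDr.
apply: le_trans eM; apply: ler_pM; rewrite ?(sub_norm_ge0 he) //.
  by apply: le_trans (pnormX (normr_submultiplicative K) _) _; rewrite normr1 mulr1.
apply: le_trans (P_bound k.+1); apply: le_trans (sub_norm_sum he _ _ _) _.
apply: ler_sum => j _; apply: le_trans (norm_horner he _ ler01 IH) _.
by apply: pnorm_mono => // a; apply: pnorm1_le e0 implicit_radius_le.
Qed.

(** The difference is divisible by t^m and has norm at most 2 at radius e; halving the radius gains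
    2^-m. *)
Lemma implicit_iter_cauchy m n : (m <= n)%N -> pnorm1 (e / 2) (s n - s m) <= 2 / 2 ^+ m.
Proof.
move=> mn; have e0 := implicit_radius_gt0.
have [q hq] : exists q, s n - s m = q * 'X^m.
  elim: n mn => [|n IH]; first by rewrite leqn0 => /eqP ->; exists 0; rewrite subrr mul0r.
  rewrite leq_eqVlt => /predU1P [->|]; first by exists 0; rewrite subrr mul0r.
  rewrite ltnS => mn; have [q hq] := IH mn; have [b hb] := implicit_iter_dvd n.
  exists (b * 'X^(n.+1 - m) + q); rewrite mulrDl -mulrA -exprD subnK ?(leqW mn) //.
  by rewrite -hb -hq addrA subrK.
have he := pnorm1_submultiplicative (ltW e0).
have e2 : 0 <= e / 2 by rewrite divr_ge0 // ltW.
have e2e : e / 2 <= e by rewrite ler_pdivrMr // ler_pMr // ler1n.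
have := pnorm_dvdXn (normr_submultiplicative K) e2 e2e (ex_intro _ q hq).
rewrite -[pnorm _ _ _]/(pnorm1 _ _) -[pnorm _ e _]/(pnorm1 _ _) (expr_div_n e 2) => h.
have em : 0 < e ^+ m by rewrite exprn_gt0.
rewrite -(ler_pM2r em); apply: le_trans h _.
rewrite [leLHS]mulrC mulrA mulrAC (ler_pM2r em).
rewrite ler_wpM2r ?invr_ge0 ?exprn_ge0 //.
apply: le_trans (sub_normD he _ _) _; rewrite (sub_normN he).
by rewrite -[2]/(1 + 1) lerD ?implicit_iter_norm.
Qed.

End ImplicitSeries.

(** * Expansion of f along the prospective curve *)

Section Expansion.
Variables (K : numFieldType) (n : nat) (c : multinom n -> K) (m : nat).
Variables (u w : 'rV[K]_n) (l : 'I_n) (d S : K).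
Hypothesis low0 : forall j, (j < m)%N -> homog_part c j = 0.
Hypothesis fu0 : eval (homog_part c m) u = 0.
Hypothesis fw0 : 2^-1 * pairing (grad (homog_part c m) u) w + eval (homog_part c m.+1) u = 0.
Hypothesis d_gt0 : 0 < d.
Hypothesis bound_S : forall N, \sum_(j < N) homog_bound c j * d ^+ j <= S.

Notation a := (grad (homog_part c m) u 0 l).
Hypothesis a_neq0 : a != 0.

Definition branch_point (tau s : K) : 'rV[K]_n :=
  tau *: u + (2^-1 * tau ^+ 2) *: w + (tau ^+ 2 * s) *: delta_mx 0 l.

(** [v] is the branch point divided by t. The constant term vanishes by f_m(u) = 0, and in degree
    one the second-order equation for w cancels everything but a z. *)
Lemma initial_forms_along (A : comNzRingType) (h : {rmorphism K -> A}) (t z : A) :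
  let v i := h (u 0 i) + t * (h (2^-1 * w 0 i) + (i == l)%:R * z) in
  exists r, mmap h v (homog_part c m) + t * mmap h v (homog_part c m.+1) =
    t * (h a * z) + t ^+ 2 * r.
Proof.
pose y i := h (2^-1 * w 0 i) + (i == l)%:R * z.
have [r hr] := mpoly_taylor h (u 0) t y (homog_part c m).
have [s hs] := mpoly_taylor h (u 0) t y (homog_part c m.+1).
set D := \sum_(i < n) _ in hs.
have hD : \sum_(i < n) h (meval (u 0) (mderiv i (homog_part c m))) * y i =
    h (2^-1 * pairing (grad (homog_part c m) u) w) + h a * z.
  rewrite /y; under eq_bigr do rewrite mulrDr; rewrite big_split /=; congr (_ + _).
    rewrite /pairing mulr_sumr rmorph_sum; apply: eq_bigr => i _.
    by rewrite -rmorphM !mxE mulrCA.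
  rewrite (bigD1 l) //= eqxx mul1r big1 ?addr0 ?mxE // => i il.
  by rewrite (negPf il) mul0r mulr0.
(* [r] comes from f_m; D + t s comes from f_(m+1), which already carries a factor t. *)
exists (r + D + t * s); rewrite /= hr hs hD.
have -> : meval (u 0) (homog_part c m) = 0 by exact: fu0.
have -> : meval (u 0) (homog_part c m.+1) = - (2^-1 * pairing (grad (homog_part c m) u) w).
  by apply/eqP; rewrite -addr_eq0 addrC; apply/eqP; exact: fw0.
rewrite rmorph0 rmorphN; move: (h _) (h a * z) => b b'; ring.
Qed.

Definition bipolyC : {rmorphism K -> {poly {poly K}}} := polyC \o polyC.

(** [P j] is the part of H coming from f_(m+2+j), scaled by -1/a; [P 0] also absorbs the Taylor
    remainder of the two lowest forms. The identity concerns partial sums, so that only polynomials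
    are evaluated. *)
Lemma bivariate_expansion : exists (P : nat -> {poly {poly K}}) (r M : K),
  [/\ 0 < r <= 1, r * (`|u| + `|w| + 2) <= d,
      (forall N, \sum_(j < N) pnorm2 r (P j) <= M),
      (forall j, exists Q, P j = Q * ('X^j)%:P) &
      forall k (sigma : {poly K}) (tau : K),
        \sum_(j < m.+2 + k.+1) eval (homog_part c j) (branch_point tau sigma.[tau]) =
        a * tau ^+ m.+1 *
          (sigma.[tau] - ('X * \sum_(j < k.+1) (P j).[sigma]).[tau])].
Proof.
pose h := bipolyC.
pose t : {poly {poly K}} := 'X%:P.
pose v i := h (u 0 i) + t * (h (2^-1 * w 0 i) + (i == l)%:R * 'X).
pose V j := mmap h v (homog_part c j).
have [rr hrr] := initial_forms_along h t 'X.
pose P j := h (- a^-1) * (t ^+ j * V (m.+2 + j) + (j == 0%N)%:R * rr).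
(* [B] bounds the norm of every [v i]; the summand 2 covers the variable s and keeps [B]
   positive. *)
pose B := `|u| + `|w| + 2; have B0 : 0 < B by rewrite ltr_wpDl // addr_ge0.
have [r [r0 r1 rB]] : exists r : K, [/\ 0 < r, r <= 1 & r * B <= d].
  have dB0 : 0 < B + d by rewrite addr_gt0.
  exists (d / (B + d)); split; first exact: divr_gt0.
    by rewrite ler_pdivrMr // mul1r lerDr ltW.
  by rewrite mulrAC ler_pdivrMr // ler_wpM2l ?(ltW d_gt0) // lerDl ltW.
have h2 := pnorm2_submultiplicative (ltW r0).
have hN := normr_submultiplicative K.
have h1 := pnorm1_submultiplicative (ltW r0).
have nh b : pnorm2 r (h b) <= `|b| by rewrite /h /bipolyC /= /pnorm2 (pnormC h1) /pnorm1 (pnormC hN).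
have nt : pnorm2 r t <= r.
  by rewrite /pnorm2 (pnormC h1) (le_trans (pnormX hN _)) // normr1 mulr1.
have nX : pnorm2 r 'X <= 1.
  by apply: le_trans (pnormX h1 _) _; rewrite mul1r (sub_norm1 h1).
have nv i : pnorm2 r (v i) <= B.
  apply: le_trans (sub_normD h2 _ _) _; rewrite /B -addrA lerD //.
    by apply: le_trans (nh _) _; exact: entry_norm_le.
  apply: le_trans (sub_normM h2 _ _) _.
  rewrite -[leRHS]mul1r; apply: ler_pM; rewrite ?(sub_norm_ge0 h2) ?(le_trans nt) //.
  apply: le_trans (sub_normD h2 _ _) _; apply: lerD.
    apply: le_trans (nh _) _; rewrite normrM -[leRHS]mul1r; apply: ler_pM => //; last exact: entry_norm_le.
    by rewrite ger0_norm ?invr_ge0 // invf_le1 ?ler1n.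
  case: eqP => _; rewrite ?mul1r ?mul0r ?(sub_norm0 h2) //.
  by apply: le_trans nX _; rewrite ler1n.
exists P, r, (`|a^-1| * (S / r ^+ m.+2 + pnorm2 r rr)); split=> //; first by rewrite r0.
- move=> N.
  have nP j : pnorm2 r (P j) <= `|a^-1| *
      (homog_bound c (m.+2 + j) * d ^+ (m.+2 + j) / r ^+ m.+2 + (j == 0%N)%:R * pnorm2 r rr).
    apply: le_trans (sub_normM h2 _ _) _; apply: ler_pM; rewrite ?(sub_norm_ge0 h2) //.
      by apply: le_trans (nh _) _; rewrite normrN.
    apply: le_trans (sub_normD h2 _ _) _; apply: lerD; last first.
      by case: eqP => _; rewrite ?mul1r ?mul0r ?(sub_norm0 h2).
    have rm : 0 < r ^+ m.+2 by rewrite exprn_gt0.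
    (* The factor r^(m+2) completes r^j, the bound for t^j, to r^(m+2+j); together with B^(m+2+j)
       this is a power of r B <= d. *)
    rewrite ler_pdivlMr //; apply: le_trans (_ : r ^+ (m.+2 + j) * (homog_bound c (m.+2 + j) * B ^+ (m.+2 + j)) <= _).
      rewrite exprD -[r ^+ m.+2 * _ * _]mulrA mulrC ler_wpM2l ?(ltW rm) //.
      apply: le_trans (sub_normM h2 _ _) _; apply: ler_pM; rewrite ?(sub_norm_ge0 h2) //.
        apply: le_trans (sub_normX h2 _ _) _; rewrite lerXn2r ?nnegrE ?(sub_norm_ge0 h2) //.
        exact: ltW.
      exact: (mmap_homog_part_le h2).
    rewrite mulrCA -exprMn ler_wpM2l ?homog_bound_ge0 // lerXn2r ?nnegrE ?mulr_ge0 ?(ltW r0) ?(ltW B0) ?(ltW d_gt0) //.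
  apply: (@le_trans _ _ (\sum_(j < N) `|a^-1| *
    (homog_bound c (m.+2 + j) * d ^+ (m.+2 + j) / r ^+ m.+2 + ((j : nat) == 0%N)%:R * pnorm2 r rr))).
    by apply: ler_sum => j _; exact: nP.
  rewrite -mulr_sumr ler_wpM2l // big_split /=; apply: lerD.
    rewrite -mulr_suml ler_wpM2r ?invr_ge0 ?exprn_ge0 ?(ltW r0) //.
    apply: le_trans (bound_S (m.+2 + N)); rewrite big_split_ord /= lerDr.
    by apply: sumr_ge0 => j _; rewrite mulr_ge0 ?homog_bound_ge0 ?exprn_ge0 ?(ltW d_gt0).
  case: N => [|N]; first by rewrite big_ord0 (sub_norm_ge0 h2).
  by rewrite big_ord_recl eqxx mul1r big1 ?addr0 // => j _; rewrite mul0r.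
- case=> [|j]; first by exists (P 0%N); rewrite expr0 mulr1.
  exists (h (- a^-1) * V (m.+2 + j.+1)).
  by rewrite /P mul0r addr0 -mulrA [V _ * _]mulrC polyC_exp.
- move=> k sigma tau.
  (* The substitution t := tau, s := sigma(tau), as a ring morphism from K[t][s] to K. *)
  have [psi [psih psit psiX psiE]] : exists psi : {rmorphism {poly {poly K}} -> K},
      [/\ forall b, psi (h b) = b, psi t = tau, psi 'X = sigma.[tau] &
        forall p, psi p = p.[sigma].[tau]].
    exists (horner_eval tau \o horner_eval sigma).
    by split=> [b|||p]; rewrite /h /bipolyC /t /= /horner_eval ?hornerC ?hornerX ?hornerC.
  have psiV j : eval (homog_part c j) (branch_point tau sigma.[tau]) = tau ^+ j * psi (V j).
    have -> : branch_point tau sigma.[tau] = tau *: \row_i psi (v i).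
      apply/rowP => i; rewrite !mxE /v !rmorphD !rmorphM rmorphD !rmorphM !psih psit psiX rmorph_nat /=.
      by rewrite eq_sym; ring.
    rewrite eval_homog_partZ /V (rmorph_mmap _ _ psih); congr (_ * _).
    by apply: meval_eq => i; rewrite mxE.
  under eq_bigr do rewrite psiV.
  (* Degrees below m vanish, degrees m and m + 1 are handled by [hrr], and the others form the sum
     of the [P j]. *)
  rewrite big_split_ord /= 2!big_ord_recr /=.
  rewrite big1 ?add0r; last first.
    by move=> j _; rewrite /V low0 // mmap0 rmorph0 mulr0.
  have -> : ('X * \sum_(j < k.+1) (P j).[sigma]).[tau] = psi (t * \sum_(j < k.+1) P j).
    by rewrite psiE /t [(_ * _).[sigma] in RHS]hornerM hornerC horner_sum.
  rewrite rmorphM psit [psi (\sum_(j < _) P j)]rmorph_sum.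
  have -> : \sum_(j < k.+1) psi (P j) = - a^-1 * (\sum_(j < k.+1) tau ^+ j * psi (V (m.+2 + j)) + psi rr).
    rewrite mulrDr mulr_sumr; under eq_bigr do rewrite rmorphM rmorphD !rmorphM rmorphXn psih psit rmorph_nat mulrDr.
    rewrite big_split /=; congr (_ + _).
    by rewrite big_ord_recl eqxx mul1r big1 ?addr0 // => j _; rewrite mul0r mulr0.
  have hpsi : psi (V m) + tau * psi (V m.+1) = tau * (a * sigma.[tau]) + tau * tau * psi rr.
    by have := congr1 psi hrr; rewrite !rmorphD expr2 !rmorphM psih psit psiX.
  under [X in _ + X = _]eq_bigr do rewrite exprD -mulrA.
  rewrite -mulr_sumr; move: (\sum_(j < k.+1) _) => s.
  rewrite [tau ^+ m.+1]exprS exprS.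
  have -> : tau ^+ m * psi (V m) + tau * tau ^+ m * psi (V m.+1) =
     tau ^+ m * (tau * (a * sigma.[tau]) + tau * tau * psi rr) by rewrite -hpsi; ring.
  by rewrite !exprS; field.
Qed.

End Expansion.

(** * Construction of the analytic branch *)

Section Branch.
Variables (K : numFieldType) (hK : geometrically_complete K).

(** Composition with X + t0, whose norm at radius R - |t0| is at most R, preserves the Cauchy bound,
    so [pnorm_complete] applies around t0. *)
Lemma limit_analytic_at (q : nat -> {poly K}) (R C t0 : K) : `|t0| < R ->
  (forall m n, (m <= n)%N -> pnorm1 R (q n - q m) <= C / 2 ^+ m) ->
  exists a : nat -> K, forall t, `|t - t0| <= R - `|t0| ->
    exists2 l : K, (fun k => (q k).[t] : K) @ \oo --> l &
      series (fun k => a k * (t - t0) ^+ k) @ \oo --> l.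
Proof.
move=> t0R hq; have r0 : 0 < R - `|t0| by rewrite subr_gt0.
have R0 : 0 < R by apply: le_lt_trans t0R.
have hN := normr_submultiplicative K.
have [|a ha] := @pnorm_complete K hK (fun k => q k \Po ('X + t0%:P)) _ C r0.
  move=> m n mn; rewrite -comp_polyB; apply: le_trans (hq m n mn).
  apply: (pnorm_comp hN); rewrite ?(ltW r0) ?(ltW R0) //.
  apply: le_trans (sub_normD (pnorm1_submultiplicative (ltW r0)) _ _) _.
  rewrite /pnorm1 (pnormC hN) -lerBrDr; apply: le_trans (pnormX hN _) _.
  by rewrite normr1 mulr1.
exists a => t /ha [l hl sl]; exists l => //.
by move: hl; under eq_fun do rewrite horner_comp hornerD hornerX hornerC subrK.
Qed.

Variables (n : nat) (f : 'rV[K]_n -> K) (c : multinom n -> K) (m : nat).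

(** On the ball of radius d / 2 the tails are at most S / 2^N uniformly, and the partial sums are
    continuous. *)
Lemma power_series_continuous (d S : K) (x_ : nat -> 'rV[K]_n) (x : 'rV[K]_n) : 0 < d ->
  (forall N, \sum_(j < N) homog_bound c j * d ^+ j <= S) ->
  (forall x, `|x| <= d ->
    (fun N => \sum_(j < N) eval (homog_part c j) x : K) @ \oo --> f x) ->
  x_ @ \oo --> x -> (forall k, `|x_ k| <= d / 2) -> `|x| <= d / 2 ->
  (fun k => f (x_ k) : K) @ \oo --> f x.
Proof.
move=> d0 hS hf hx hxk hx2.
have S0 : 0 <= S by have := hS 0%N; rewrite big_ord0.
have d2 : d / 2 <= d by rewrite ler_pdivrMr // ler_pMr // ler1n.
have tail z N : `|z| <= d / 2 -> `|f z - \sum_(j < N) eval (homog_part c j) z| <= S / 2 ^+ N.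
  move=> hz; have := power_series_tail d0 hS N hz d2 (hf _ (le_trans hz d2)).
  by rewrite mulrAC mulfV ?gt_eqF // mul1r exprVn.
apply/cvgrPdist_le => e e0; have e2 : 0 < e / 2 by rewrite divr_gt0.
have [M _ hM] := geometric_eps hK.1 (addr_ge0 S0 S0) e2.
have hMM := hM M (leqnn _).
have : (fun k => \sum_(j < M) eval (homog_part c j) (x_ k) : K) @ \oo -->
    \sum_(j < M) eval (homog_part c j) x.
  apply: cvg_big; first exact: add_continuous.
  by move=> j _; exact: cvg_eval.
move=> /cvgrPdist_le /(_ _ e2); apply: filterS => k hk.
rewrite [e]splitr; apply: le_trans (lerD hMM hk).
rewrite mulrDl -addrA [S / _ + `|_|]addrC addrA.
apply: le_trans (ler_distD (\sum_(j < M) eval (homog_part c j) (x_ k)) _ _) _; apply: lerD.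
  apply: le_trans (ler_distD (\sum_(j < M) eval (homog_part c j) x) _ _) _.
  by rewrite lerD2r; exact: tail.
by rewrite distrC; exact: tail.
Qed.

Variables (u w : 'rV[K]_n) (l : 'I_n).
Hypothesis f_series : has_power_series f 0 c.
Hypothesis low0 : forall j, (j < m)%N -> homog_part c j = 0.
Hypothesis fu0 : eval (homog_part c m) u = 0.
Hypothesis fw0 : 2^-1 * pairing (grad (homog_part c m) u) w + eval (homog_part c m.+1) u = 0.
Hypothesis a_neq0 : grad (homog_part c m) u 0 l != 0.

Lemma norm_delta_mx_le1 : `|delta_mx 0 l : 'rV[K]_n| <= 1.
Proof.
by apply: mx_norm_le => // i j; rewrite mxE; case: (_ && _); rewrite ?normr1 ?normr0 ?ler01.
Qed.

Lemma norm_branch_point (t s : K) : `|t| <= 1 -> `|s| <= 1 ->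
  `|branch_point u w l t s| <= `|t| * (`|u| + `|w| + 2).
Proof.
move=> t1 s1; have delta1 := norm_delta_mx_le1.
have t2 : `|t| ^+ 2 <= `|t| by rewrite expr2 ler_piMr.
have h2 : `|2^-1| <= 1 :> K by rewrite ger0_norm ?invr_ge0 // invf_le1 ?ler1n.
rewrite /branch_point mulrDr [`|t| * (_ + `|w|)]mulrDr.
apply: le_trans (ler_normD _ _) _; apply: lerD.
  apply: le_trans (ler_normD _ _) _; apply: lerD; first by rewrite normrZ.
  rewrite normrZ normrM normrX ler_wpM2r //.
  by rewrite -[leRHS]mul1r; apply: ler_pM; rewrite ?exprn_ge0.
rewrite normrZ normrM normrX -mulrA; apply: ler_pM => //; rewrite ?exprn_ge0 ?mulr_ge0 //.
apply: (@le_trans _ _ (1 * 1)); first exact: ler_pM.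
by rewrite mulr1 ler1n.
Qed.

(** [gamma t] is the branch point at sigma(t) = lim s_k(t). The cubic error comes from |sigma(t)| <=
    |t| / e0. *)
Lemma analytic_branch : exists (e B : K) (gamma : K -> 'rV[K]_n),
  [/\ 0 < e, 0 <= B,
    (forall t, `|t| <= e -> `|gamma t - (t *: u + (2^-1 * t ^+ 2) *: w)| <= B * `|t| ^+ 3),
    (forall t, `|t| <= e -> f (gamma t) = 0) &
    forall t0, `|t0| < e -> forall i, exists a : nat -> K, forall t, `|t - t0| <= e - `|t0| ->
      series (fun k => a k * (t - t0) ^+ k) @ \oo --> gamma t 0 i].
Proof.
have [d [S [d0 [hS hf]]]] := power_series_bound f_series.
have [P [r [M [/andP[r0 r1] rd hM Pdvd hP]]]] :=
  bivariate_expansion low0 fu0 fw0 d0 hS a_neq0.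
pose s := implicit_iter P.
pose e0 := implicit_radius r M; pose e := e0 / 2.
have e0_gt0 : 0 < e0 by exact: (implicit_radius_gt0 r0 hM).
have e_gt0 : 0 < e by rewrite divr_gt0.
have ee0 : e <= e0 by rewrite ler_pdivrMr // ler_pMr // ler1n.
have e0r : e0 <= r by exact: (implicit_radius_le r0 hM).
have er : e <= r / 2 by rewrite ler_pM2r ?invr_gt0.
have hN := normr_submultiplicative K.
have s_norm k : pnorm1 e0 (s k) <= 1 by exact: (implicit_iter_norm r0 hM).
have s_cauchy k k' : (k <= k')%N -> pnorm1 e (s k' - s k) <= 2 / 2 ^+ k.
  exact: (implicit_iter_cauchy r0 hM Pdvd).
have s_dist t k k' : `|t| <= e -> (k <= k')%N -> `|(s k').[t] - (s k).[t]| <= 2 / 2 ^+ k.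
  move=> te kk'; apply: le_trans (s_cauchy _ _ kk').
  by rewrite -hornerN -hornerD (norm_horner hN) // ltW.
have s_small t k : `|t| <= e -> `|(s k).[t]| <= e0^-1 * `|t|.
  (* Write s_k = q t: the norm of s_k at radius e0 is at most 1, so that of [q] is at most 1 /
     e0. *)
  move=> te; have [q hq] := implicit_iter_dvdX P k.
  have := s_norm k; rewrite /s hq /pnorm1 (pnormMX hN) -ler_pdivlMr // mul1r => hq1.
  rewrite hornerM hornerX normrM ler_wpM2r //; apply: le_trans hq1.
  by apply: (norm_horner hN); [exact: ltW|exact: le_trans te ee0].
have s_le1 t k : `|t| <= e -> `|(s k).[t]| <= 1.
  by move=> te; apply: le_trans (s_small _ _ te) _; rewrite mulrC ler_pdivrMr // mul1r (le_trans te).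
have : forall t, exists y : K, `|t| <= e -> (fun k => (s k).[t] : K) @ \oo --> y.
  (* Outside the disc [|t| <= e], 0 is a default value. *)
  move=> t; have [te|te] := boolP (`|t| <= e); last by exists 0.
  by have [y hy] := hK.2 _ _ (fun k k' => @s_dist t k k' te); exists y.
move=> /choice [sigma hsigma].
have sigma_small t : `|t| <= e -> `|sigma t| <= e0^-1 * `|t|.
  by move=> te; apply: (@norm_cvg_le K K _ _ _ (hsigma t te)); exists 0%N => // k _; exact: s_small.
have sigma_le1 t : `|t| <= e -> `|sigma t| <= 1.
  by move=> te; apply: (@norm_cvg_le K K _ _ _ (hsigma t te)); exists 0%N => // k _; exact: s_le1.
have bp_small t y : `|t| <= e -> `|y| <= 1 -> `|branch_point u w l t y| <= d / 2.
  move=> te y1; apply: le_trans (norm_branch_point _ y1) _.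
    by rewrite (le_trans te) // (le_trans ee0) // (le_trans e0r).
  apply: le_trans (_ : r / 2 * (`|u| + `|w| + 2) <= _).
    by rewrite ler_wpM2r ?addr_ge0 // (le_trans te).
  by rewrite mulrAC ler_pM2r ?invr_gt0.
pose gamma t := branch_point u w l t (sigma t).
have gamma_cvg t : `|t| <= e ->
    (fun k => branch_point u w l t (s k).[t]) @ \oo --> gamma t.
  move=> te; apply: cvgD; first exact: cvg_cst.
  by apply: cvgZl; apply: (@cvgMr K); exact: hsigma.
exists e, e0^-1, gamma; split=> //.
- by rewrite invr_ge0 ltW.
- move=> t te; rewrite /gamma /branch_point addrC addKr.
  rewrite normrZ normrM normrX.
  apply: (@le_trans _ _ (`|t| ^+ 2 * (e0^-1 * `|t|) * 1)).
    apply: ler_pM; rewrite ?mulr_ge0 ?exprn_ge0 ?norm_delta_mx_le1 //.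
    by rewrite ler_wpM2l ?exprn_ge0 // sigma_small.
  by rewrite mulr1 mulrCA -exprSr.
- move=> t te; apply: (seq_limit_unique (v := fun k => f (branch_point u w l t (s k).[t]))).
    apply: (power_series_continuous d0 hS hf (gamma_cvg t te)).
      by move=> k; apply: bp_small => //; exact: s_le1.
    by apply: bp_small => //; exact: sigma_le1.
  (* [S] controls the tail of the series of f; the other summand controls a t^(m+1) (s_k - s_(k+1)),
     to which [hP] reduces the partial sum. *)
  pose C := S + `|grad (homog_part c m) u 0 l * t ^+ m.+1| * 2.
  apply: (@squeeze_cvg0 _ _ (fun k => C * 2^-1 ^+ k)); last first.
    by rewrite -(mulr0 C); apply: (@cvgMr K); exact: hK.1.
  exists 0%N => // k _ /=.
  rewrite -[X in `|X|](subrK (\sum_(j < m.+2 + k.+1) eval (homog_part c j) (branch_point u w l t (s k).[t]))).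
  apply: le_trans (ler_normD _ _) _; rewrite mulrDl; apply: lerD.
    have xd : `|branch_point u w l t (s k).[t]| <= d / 2 by apply: bp_small => //; exact: s_le1.
    have d2 : d / 2 <= d by rewrite ler_pdivrMr // ler_pMr // ler1n.
    apply: le_trans (power_series_tail d0 hS _ xd d2 (hf _ (le_trans xd d2))) _.
    rewrite mulrAC mulfV ?gt_eqF // mul1r ler_wpM2l //.
      by have := hS 0%N; rewrite big_ord0.
    apply: ler_wiXn2l; rewrite ?invr_ge0 // ?invf_le1 ?ler1n //.
    by rewrite addnS -addSn leq_addl.
  rewrite hP -[X in _ - X.[t]]/(s k.+1) normrM -mulrA ler_wpM2l // exprVn distrC.
  by apply: s_dist.
- move=> t0 t0e i.
  (* The i-th coordinate of the branch point at s_k, as a polynomial in t. *)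
  pose q k : {poly K} := u 0 i *: 'X + (2^-1 * w 0 i) *: 'X^2 + (delta_mx 0 l : 'rV[K]_n) 0 i *: ('X^2 * s k).
  have he := pnorm1_submultiplicative (ltW e_gt0).
  have [|a ha] := @limit_analytic_at q e (pnorm1 e ((delta_mx 0 l : 'rV[K]_n) 0 i *: 'X^2) * 2) t0 t0e.
    move=> k k' kk'; rewrite /q opprD addrACA subrr add0r -scalerBr -mulrBr scalerAl.
    apply: le_trans (sub_normM he _ _) _; rewrite -mulrA ler_wpM2l ?(sub_norm_ge0 he) //.
    exact: s_cauchy.
  exists a => t ht; have [y hy ay] := ha t ht.
  suff -> : gamma t 0 i = y by [].
  have te : `|t| <= e.
    by rewrite -[t](subrK t0) (le_trans (ler_normD _ _)) // -lerBrDr.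
  apply: (seq_limit_unique (cvg_coord (i:=i) (gamma_cvg t te))).
  move: hy; rewrite (_ : (fun k => (q k).[t]) = (fun k => branch_point u w l t (s k).[t] 0 i)) //.
  apply/funext => k; rewrite /q !hornerD !hornerZ [(_ * s k).[t]]hornerM hornerX !hornerXn !mxE; ring.
Qed.

End Branch.

(** * Realizability and equality of the two tangent sets *)

Lemma real_or_complex_complete (R : realType) (K : numFieldType) :
  real_or_complex R K -> geometrically_complete K.
Proof. by case; [exact: real_geometrically_complete|exact: complex_geometrically_complete]. Qed.

Lemma small_radius (K : numFieldType) (e eta Q : K) : 0 < e -> 0 < eta -> 0 <= Q ->
  exists r : K, [/\ 0 < r, r <= e, r <= 1 & r * Q <= eta].
Proof.
(* [D] dominates e^-1, 1 and Q / eta, so its inverse meets all three bounds without taking a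
   minimum. *)
move=> e0 eta0 Q0; pose D := e^-1 + 1 + Q / eta.
have h1 : 0 < e^-1 by rewrite invr_gt0.
have h3 : 0 <= Q / eta by rewrite divr_ge0 // ltW.
have D0 : 0 < D by rewrite ltr_wpDr // addr_gt0.
exists D^-1; split; rewrite ?invr_gt0 //.
- by rewrite -[leRHS]invrK lef_pV2 ?posrE // /D -addrA lerDl addr_ge0.
- by rewrite invf_le1 // /D addrAC lerDr addr_ge0 // ltW.
- by rewrite mulrC ler_pdivrMr // mulrC -ler_pdivrMr // /D lerDr addr_ge0 // ltW.
Qed.

Section Realizability.
Variables (K : numFieldType) (hK : geometrically_complete K) (n : nat) (X : set 'rV[K]_n).
Variable u : 'rV[K]_n.

(** As f lies in the ideal of X, the tangent cone and w supply the two equations needed by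
    [analytic_branch]; the interval is then shrunk to keep the curve where X is the zero set of
    f. *)
Lemma hypersurface_realizable (f : 'rV[K]_n -> K) (c : multinom n -> K) (m : nat) :
  analytic_germ f -> has_power_series f 0 c -> initial_degree c m ->
  (\forall x \near (0 : 'rV[K]_n), X x <-> f x = 0) ->
  tangent_cone X u -> grad (homog_part c m) u != 0 ->
  second_order_realizable X u.
Proof.
move=> f_analytic fc fm X_def u_tangent grad_neq0 w hw.
have fI : vanishing_ideal X f.
  by split=> //; apply: filterS X_def => x [].
have fu0 := initial_form_tangent_cone fI fc fm u_tangent.
have fw0 := hw _ _ _ fI fc fm.
have [l al] : exists l, grad (homog_part c m) u 0 l != 0 by exact/rV0Pn.
have [e [B [gamma [e0 B0 hg fg ag]]]] := analytic_branch hK fc fm.1 fu0 fw0 al.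
have [eta /= eta0 hX] := (nbhs_norm0P).1 X_def.
(* For |t| <= 1, |gamma t| <= |t| Q. *)
pose Q := `|u| + `|w| + B; have Q0 : 0 <= Q by rewrite !addr_ge0.
have [r [r0 re r1 rQ]] := small_radius e0 eta0 Q0.
exists r, gamma; split=> //.
- move=> t /andP[t0 tr]; have te : `|t| <= e by rewrite gtr0_norm // ltW // (lt_le_trans tr).
  apply/(hX (gamma t)); last exact: fg.
  have t1 : `|t| <= 1 by rewrite gtr0_norm // ltW // (lt_le_trans tr).
  have h2 : `|2^-1| <= 1 :> K by rewrite ger0_norm ?invr_ge0 // invf_le1 ?ler1n.
  apply: (@le_lt_trans _ _ (`|t| * Q)).
    rewrite -[gamma t](subrK (t *: u + (2^-1 * t ^+ 2) *: w)) addrC.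
    apply: le_trans (ler_normD _ _) _; rewrite /Q !mulrDr; apply: lerD.
      apply: le_trans (ler_normD _ _) _; apply: lerD; first by rewrite normrZ.
      rewrite normrZ normrM normrX ler_wpM2r // -[leRHS]mul1r.
      by apply: ler_pM; rewrite ?exprn_ge0 // expr2 ler_piMr.
    apply: le_trans (hg _ te) _; rewrite mulrC ler_wpM2r // exprS ler_piMr //.
    by rewrite exprn_ile1.
  (* Strictness of t Q < r Q requires Q to be nonzero. *)
  have [Q00|Q00] := eqVneq Q 0; first by rewrite Q00 mulr0.
  by apply: lt_le_trans rQ; rewrite ltr_pM2r ?gtr0_norm // lt_neqAle eq_sym Q00.
- move=> t0 /andP[t00 t0r] i.
  have t0e : `|t0| < e by rewrite gtr0_norm // (lt_le_trans t0r).
  have [a ha] := ag _ t0e i; exists a.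
  have : \forall t \near t0, `|t - t0| <= e - `|t0|.
    apply/nbhs_ballP; exists (e - `|t0|) => /=; first by rewrite subr_gt0.
    by move=> t; rewrite /ball /= distrC => /ltW.
  by apply: filterS => t ht _; exact: ha.
- apply/eqaddoP => eps eps0.
  have [d [d0 de _ dB]] := small_radius e0 eps0 B0.
  have : \forall t \near (0 : K), `|t| <= d by exact: nbhs0_le.
  apply: filterS => t td _ /=.
  apply: le_trans (hg _ (le_trans td de)) _.
  rewrite exprS normrX mulrA ler_wpM2r ?exprn_ge0 //.
  by apply: le_trans dB; rewrite mulrC ler_wpM2r.
Qed.

(** The curve is sampled at a geometric sequence t_k, and w_k is solved from the value at t_k; the
    o(t^2) term gives w_k -> w. *)
Lemma realizable_second_tangent_set :
  second_order_realizable X u -> algebraic_second_tangent_set X u `<=` second_tangent_set X u.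
Proof.
move=> hr w /hr [e [gamma [e0 hX _ ho]]].
(* The exponent k + 1 keeps t_0 strictly below e. *)
pose t k := e / 2 ^+ k.+1.
have t0 k : 0 < t k by rewrite divr_gt0 // exprn_gt0.
have te k : t k < e.
  by rewrite ltr_pdivrMr ?exprn_gt0 // ltr_pMr // exprn_egt1 // ltr1n.
have tcvg : t @ \oo --> (0 : K).
  rewrite (_ : t = fun k => e / 2 * 2^-1 ^+ k).
    by rewrite -(mulr0 (e / 2)); apply: (@cvgMr K); exact: hK.1.
  by apply/funext => k; rewrite /t exprS invfM exprVn mulrA.
pose w_ k := (2 / t k ^+ 2) *: (gamma (t k) - t k *: u).
have half2 k : 2 / t k ^+ 2 * (2^-1 * t k ^+ 2) = 1.
  by rewrite mulrACA [t k ^- 2 * _]mulrC !mulfV ?mulr1 ?pnatr_eq0 // expf_neq0 // gt_eqF.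
exists t, w_; split=> //.
- split=> // k k' kk'; rewrite ler_pM2l // lef_pV2 ?posrE ?exprn_gt0 //.
  by rewrite ler_weXn2l ?ler1n.
- apply/cvgrPdist_le => eps eps0.
  (* The half compensates the factor 2 in [w_]. *)
  have eps2 : 0 < eps / 2 by rewrite divr_gt0.
  have := (eqaddoP _ _ _ _).1 ho _ eps2 => near_o.
  have [N _ hN] := tcvg _ near_o; exists N => // k /= Nk; have hk := hN k Nk (t0 k).
  have tk2 : 0 < t k ^+ 2 by rewrite exprn_gt0.
  have -> : w - w_ k = - ((2 / t k ^+ 2) *: (gamma (t k) - (t k *: u + (2^-1 * t k ^+ 2) *: w))).
    by rewrite opprD addrA [in RHS]scalerBr scalerA half2 scale1r opprB.
  rewrite normrN normrZ gtr0_norm ?divr_gt0 //.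
  rewrite mulrAC ler_pdivrMr //.
  apply: le_trans (ler_wpM2l _ hk) _ => //.
  by rewrite mulrA mulrCA mulfV ?pnatr_eq0 // mulr1 gtr0_norm.
- move=> k; rewrite /w_ scalerA [_ * (2 / _)]mulrC half2 scale1r addrC subrK.
  by apply: hX; rewrite t0 te.
Qed.

End Realizability.

Theorem proposition4p5 (R : realType) (K : numFieldType)
    (HK : real_or_complex R K) (n : nat) (X : set 'rV[K]_n)
    (f : 'rV[K]_n -> K) (c : multinom n -> K) (m : nat) (u : 'rV[K]_n)
    (X0 : X 0)
    (f_analytic : analytic_germ f)
    (f_series : has_power_series f 0 c)
    (f_initial : initial_degree c m)
    (X_def : \forall x \near (0 : 'rV[K]_n), X x <-> f x = 0)
    (u_tangent : tangent_cone X u) (u_neq0 : u != 0)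
    (grad_neq0 : grad (homog_part c m) u != 0) :
  second_order_realizable X u /\
  second_tangent_set X u = algebraic_second_tangent_set X u.
Proof.
have hK := real_or_complex_complete HK.
have hr := hypersurface_realizable hK f_analytic f_series f_initial X_def u_tangent grad_neq0.
split=> //; apply/seteqP; split; first exact: second_tangent_set_sub.
exact: (realizable_second_tangent_set hK hr).
Qed.
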